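(* Fix $\kappa>0$, an integer $r\ge 1$ and $\delta>0$. For $\epsilon>0$ let $Z$ denote the solution of the backward Loewner differential equation $$dZ_t=\frac{-2/\kappa}{Z_t}\,dt+dB_t,\qquad Z_0=\epsilon i,$$ where $B$ is a standard real Brownian motion, and let $\mathcal{E}^{r}_{(V)}(Z_0,\mathbf{X}_{0,t})$ be its one-step $r$-truncated Taylor approximation on $[0,t]$. Then there is an almost surely finite random constant $C$, depending only on $r$ and $\delta$ (for the fixed $\kappa$ and the fixed Brownian path; in particular not on $\epsilon$ or $t$), such that almost surely, for all sufficiently small $\epsilon>0$, $$\left|\,Z_{t}-\mathcal{E}^{r}_{(V)}(Z_0,\mathbf{X}_{0,t})\,\right|\le C\,\epsilon\qquad\text{for all } t\in\big[0,\epsilon^{2+\delta}\big].$$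
   Context: $\mathbb{H}=\{z\in\mathbb{C}:\operatorname{Im} z>0\}$. The solution $Z$ takes values in $\mathbb{H}$, and its imaginary part is increasing in time. Vector fields: regarded as first-order differential operators acting on holomorphic functions $f$ on $\mathbb{H}$, put $$(V_0 f)(z)=\frac{-2/\kappa}{z}\,f'(z),\qquad (V_1 f)(z)=\frac{\partial f}{\partial x}(z)=f'(z)\qquad (z=x+iy),$$ and let $\mathbf{Id}(z)=z$. For a multi-index $I=(i_1,\dots,i_k)\in\{0,1\}^k$, $V_{i_1}\cdots V_{i_k}\mathbf{Id}$ denotes the function obtained by composing the operators, $V_{i_1}(V_{i_2}(\cdots(V_{i_k}\mathbf{Id})))$; for the empty multi-index it is $\mathbf{Id}$. Iterated integrals: let $X_t=(X^0_t,X^1_t)=(t,B_t)$ be space-time Brownian motion, and $$\mathbf{X}_{0,t}^{i_1,\dots,i_k}=\int_{0<s_1<\cdots<s_k<t}dX^{i_1}_{s_1}\cdots dX^{i_k}_{s_k},$$ where the integrals are all taken in the Itô sense or all taken in the Stratonovich sense (either enhancement of $X$ to a rough path may be used; versions continuous in $t$ are taken); for the empty multi-index the value is $1$. Taylor approximation: $$\mathcal{E}^{r}_{(V)}(Z_0,\mathbf{X}_{0,t})=\sum_{I=(i_1,\dots,i_k):\,\deg(I)\le r}V_{i_1}\cdots V_{i_k}\mathbf{Id}(Z_0)\,\mathbf{X}_{0,t}^{i_1,\dots,i_k},$$ where $\deg(I)=k$ is the length of $I$ and the empty multi-index (contributing $Z_0$) is included. The Brownian motion $B$ is the same for all $\epsilon$.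 *)

(* Defs.v *)
From HB Require Import structures.
From mathcomp Require Import all_boot all_order all_algebra.
From mathcomp Require Import all_classical all_reals all_analysis.
From mathcomp Require Import complex.

Set Implicit Arguments.
Unset Strict Implicit.
Unset Printing Implicit Defensive.

Import Order.TTheory GRing.Theory Num.Theory.
Import numFieldNormedType.Exports.

Local Open Scope classical_set_scope.
Local Open Scope ring_scope.
Local Open Scope complex_scope.

(** Standard Brownian motion, as a family [B t w] used for times [0 <= t]. *)

Section BrownianMotion.
Context (R : realType) (d : measure_display) (T : measurableType d).
Variables (P : probability T R) (B : R -> T -> R).

Definition independent_increments :=
  forall (n : nat) (t : nat -> R) (A : nat -> set R),
    0 <= t 0%N -> (forall k, t k <= t k.+1) -> (forall k, measurable (A k)) ->
    P [set w | forall k : 'I_n, A k (B (t k.+1) w - B (t k) w)] =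
    (\prod_(k < n) P [set w | A k (B (t k.+1) w - B (t k) w)%R])%E.

(* The second parameter of [normal_prob] is the standard deviation. *)
Definition gaussian_increments :=
  forall (s t : R) (A : set R), 0 <= s -> s < t -> measurable A ->
    P [set w | A (B t w - B s w)] = normal_prob 0 (Num.sqrt (t - s)) A.

Definition standard_brownian_motion :=
  [/\ forall t, 0 <= t -> measurable_fun setT (B t),
      {ae P, forall w, B 0 w = 0},
      independent_increments,
      gaussian_increments &
      {ae P, forall w, {within `[0, +oo[, continuous (fun t => B t w)}}].

End BrownianMotion.

(** Itô and Stratonovich integrals of continuous integrands against [B]. *)

Inductive integration_sense := Ito | Stratonovich.

Section StochasticIntegral.
Context (R : realType).

Definition tag_value (sense : integration_sense) (y : R -> R) (a c : R) : R :=
  match sense with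
  | Ito => y a
  | Stratonovich => (y a + y c) / 2
  end.

(* [s] lists the points of a partition of [[0, t]] other than [0], as in
   [itv_partition]. *)
Definition riemann_sum (sense : integration_sense) (y b : R -> R) (t : R)
    (s : seq R) : R :=
  let p := nth t (0 :: s) in
  \sum_(k < size s) tag_value sense y (p k) (p k.+1) * (b (p k.+1) - b (p k)).

Definition mesh_lt (t : R) (s : seq R) (h : R) : Prop :=
  let p := nth t (0 :: s) in
  forall k, (k < size s)%N -> p k.+1 - p k < h.

Context (d : measure_display) (T : measurableType d).

(* [J t] is the limit in probability, as the mesh of the partition of [[0, t]]
   tends to 0, of the left-endpoint (Itô) or trapezoidal (Stratonovich) Riemann
   sums of [Y] against [B].  For continuous integrands adapted to [B] (a
   continuous semimartingale in the Stratonovich case) this is the stochastic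
   integral; the iterated integrals below are of this kind. *)
Definition is_stochastic_integral (sense : integration_sense)
    (P : probability T R) (B Y J : R -> T -> R) :=
  forall t, 0 <= t -> forall a q : R, 0 < a -> 0 < q ->
    exists2 h : R, 0 < h & forall s : seq R,
      itv_partition 0 t s -> mesh_lt t s h ->
      (P [set w | (a <= `|riemann_sum sense (Y ^~ w) (B ^~ w) t s - J t w|)%R]
        < q%:E)%E.

(* Words over ['I_2] are multi-indices: the letter [0] stands for [dt] and the
   letter [1] for [dB_t].  The last letter is that of the outermost integral. *)
Record is_iterated_integrals (sense : integration_sense)
    (P : probability T R) (B : R -> T -> R)
    (X : seq 'I_2 -> R -> T -> R) : Prop := IsIteratedIntegrals {
  iterated_integral_measurable : forall I t, 0 <= t ->
    measurable_fun setT (X I t);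
  iterated_integral_continuous : forall I,
    {ae P, forall w, {within `[0, +oo[, continuous (fun t => X I t w)}};
  iterated_integral_nil : {ae P, forall w, forall t, 0 <= t ->
    X [::] t w = 1};
  iterated_integral_dt : forall I,
    {ae P, forall w, forall t, 0 <= t ->
      X (rcons I ord0) t w =
      \int[lebesgue_measure]_(s in `[0, t]) X I s w};
  iterated_integral_dB : forall I,
    is_stochastic_integral sense P B (X I) (X (rcons I ord_max))
}.

End StochasticIntegral.

Section LoewnerSDE.
Context (R : realType).
Local Notation C := (R[i] : numFieldType).

Definition upper_half_plane : set R[i] := [set z | 0 < complex.Im z].

Definition loewner_drift (kappa : R) (z : R[i]) : R[i] := (- 2 / kappa)%:C / z.

(* The noise is additive, so [dZ = drift(Z) dt + db] with [Z_0 = z0] is an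
   integral equation driven by the path [b]; the complex integral is taken
   componentwise. *)
Definition solves_loewner (kappa : R) (z0 : R[i]) (b : R -> R) (Z : R -> R[i]) :=
  [/\ {within `[0, +oo[, continuous (fun t => complex.Re (Z t))},
      {within `[0, +oo[, continuous (fun t => complex.Im (Z t))},
      forall t, 0 <= t -> upper_half_plane (Z t) &
      forall t, 0 <= t ->
        Z t = z0
          + ((\int[lebesgue_measure]_(s in `[0, t])
                complex.Re (loewner_drift kappa (Z s)))
             +i* (\int[lebesgue_measure]_(s in `[0, t])
                complex.Im (loewner_drift kappa (Z s))))
          + (b t)%:C].

(* [derive1] over the field [R[i]] is the complex derivative. *)
Definition vector_field (kappa : R) (i : 'I_2) (f : C -> C^o) : C -> C^o :=
  fun z => if i == ord0 then loewner_drift kappa z * derive1 f z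
           else derive1 f z.

Definition iterated_vector_field (kappa : R) (I : seq 'I_2) : C -> C^o :=
  foldr (vector_field kappa) id I.

Definition taylor_approximation (kappa : R) (r : nat) (z0 : R[i])
    (x : seq 'I_2 -> R) : R[i] :=
  \sum_(k < r.+1) \sum_(I : k.-tuple 'I_2)
    (iterated_vector_field kappa I z0 : R[i]) * (x I)%:C.

End LoewnerSDE.

(* Main.v *)
Require Import Defs.
From HB Require Import structures.
From mathcomp Require Import all_boot all_order all_algebra.
From mathcomp Require Import all_classical all_reals all_analysis.
From mathcomp Require Import measurable_realfun.
From mathcomp Require Import complex.
From mathcomp Require Import ring lra zify.

Set Implicit Arguments.
Unset Strict Implicit.
Unset Printing Implicit Defensive.

Import Order.TTheory GRing.Theory Num.Theory.
Import numFieldNormedType.Exports.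

Local Open Scope classical_set_scope.
Local Open Scope ring_scope.
Local Open Scope complex_scope.

(** The constant can be taken to be 1: both the solution and its Taylor
    approximation stay within [o(eps)] of the starting point [eps i] up to time
    [t <= eps ^ (2 + delta)], because Brownian motion moves by much less than
    [eps] during that time.

    Measure sizes parabolically, with [sigma] a bound of the path up to time [t]
    and [t <= sigma ^ 2]; for small [eps] one may take [sigma] to be a power
    [eps ^ (1 + gamma)] up to a constant. The imaginary part of the solution
    increases, so its drift is at most of order [1 / eps], and the solution moves
    by at most a constant times [t / eps + sigma], hence by [O(sigma)]
    ([loewner_displacement]). Give the letter [dt] weight two and the letter [dB]
    weight one. The coefficient of a word of weight [w] is a constant times
    [eps ^ (1 - w)] ([iterated_vector_field_monomial]), and its iterated integral
    is [O(sigma ^ w)] ([word_order]), so every term except the constant one is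
    [O(sigma)] too ([taylor_error]).

    The size of the iterated integrals is found path by path. Integrals over
    words [1 ... 1] are Hermite polynomials [H_a (A_t, B_t)] in the path and its
    bracket [A] (the quadratic variation for Ito integrals, zero for Stratonovich
    ones), and after a letter [dt] one has
    [\int_0^t g r * H_a (A_t - A_r, B_t - B_r) dr], where [g] is the integral over
    the part of the word before that letter. To recognize these explicit processes
    as stochastic integrals, expand them by the addition theorem of the Hermite
    polynomials ([hermiteD]): along dyadic partitions the Riemann sums of one
    process converge to the next one ([tower_riemann_sum]), as soon as the cubic
    variation vanishes and the sums of squares converge to the bracket.

    The probabilistic input is thereby reduced to marginal laws of increments.
    A diagonal extraction makes the Riemann sums of all words at all dyadic times
    converge almost surely along one sequence of levels
    ([iterated_integral_levels]); for Ito integrals the sums of squares then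
    converge as well, since the integral of [B] against itself exists
    ([square_bracket]). The Gaussian tails bound the dyadic increments and,
    by chaining, the path ([dyadic_increments_ae], [chaining]); the second moment
    bounds the bracket ([quadratic_variation_ae]). *)

(** * Hermite polynomials *)

Section Hermite.
Context (R : realType).
Implicit Types (v x y : R) (n i j k : nat).

Definition expc n x : R := x ^+ n / n`!%:R.

(** The coefficient of [l ^ n] in [exp (l x - l^2 v / 2)]: the Hermite
    polynomial of variance [v] divided by [n!], and [x ^ n / n!] for [v = 0].
    It is the [n]-fold iterated integral of a path with increment [x] and
    quadratic variation [v]. *)
Definition hermite n v x : R :=
  \sum_(i < n.+1) expc i x *
    (if (2 %| n - i)%N then expc ((n - i) %/ 2)%N (- v / 2) else 0).

Let expp N x : {poly R} := \poly_(i < N) expc i x.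

Lemma expcD n x y :
  expc n (x + y) = \sum_(i < n.+1) expc i x * expc (n - i) y.
Proof.
rewrite /expc addrC exprDn mulr_suml; apply: eq_bigr => i _.
have ile : (i <= n)%N by rewrite -ltnS.
have := bin_fact ile => /(congr1 (fun k => k%:R : R)); rewrite !natrM => <-.
have fn0 k : k`!%:R != 0 :> R by rewrite pnatr_eq0 -lt0n fact_gt0.
have b0 : 'C(n, i)%:R != 0 :> R by rewrite pnatr_eq0 -lt0n bin_gt0.
rewrite -mulr_natr; field; rewrite b0 !fn0 //.
Qed.

Let exppM N n x y : (n < N)%N -> (expp N x * expp N y)`_n = (expp N (x + y))`_n.
Proof.
move=> nN; rewrite coefM coef_poly nN expcD; apply: eq_bigr => i _.
by rewrite !coef_poly !ifT//; have := ltn_ord i; lia.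
Qed.

Let hermite_coef N n v x : (n < N)%N ->
  hermite n v x = (expp N x * (expp N (- v / 2) \Po 'X^2))`_n.
Proof.
move=> nN; rewrite coefM; apply: eq_bigr => i _.
have iN : (i < N)%N by have := ltn_ord i; lia.
rewrite coef_comp_poly_Xn// !coef_poly iN; congr (_ * _).
by case: ifP => // _; rewrite ifT//; lia.
Qed.

(** The generating series is a character, in [v] and [x] separately; products
    of series are computed on their truncations, as products of polynomials. *)
Lemma hermiteD n v w x y : hermite n (v + w) (x + y) =
  \sum_(j < n.+1) hermite j v x * hermite (n - j) w y.
Proof.
rewrite (hermite_coef _ _ (ltnSn n)).
set N := n.+1.
have -> : (expp N (x + y) * (expp N (- (v + w) / 2) \Po 'X^2))`_n =
    ((expp N x * expp N y) *
     ((expp N (- v / 2) * expp N (- w / 2)) \Po 'X^2))`_n.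
  rewrite coefM [RHS]coefM; apply: eq_bigr => i _; congr (_ * _).
    by rewrite exppM.
  rewrite !coef_comp_poly_Xn//; case: ifP => // _.
  by rewrite exppM; [congr ((expp _ _)`_ _); field|lia].
rewrite rmorphM /= mulrACA coefM; apply: eq_bigr => i _.
by rewrite -!hermite_coef//; have := ltn_ord i; lia.
Qed.

Lemma hermite0 v x : hermite 0 v x = 1.
Proof. by rewrite /hermite big_ord_recl big_ord0 /= /expc subnn div0n !fact0 !expr0; field. Qed.

Lemma hermite1 v x : hermite 1 v x = x.
Proof.
rewrite /hermite !big_ord_recl big_ord0 /= /expc /bump /=.
by rewrite (_ : ((1 - (1 + 0)) %/ 2)%N = 0%N)//= !factS fact0; field.
Qed.

Lemma hermite2 v x : hermite 2 v x = (x ^+ 2 - v) / 2.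
Proof.
rewrite /hermite !big_ord_recl big_ord0 /= /expc /bump /=.
rewrite (_ : ((2 - (1 + (1 + 0))) %/ 2)%N = 0%N)//.
by rewrite (_ : ((2 - 0) %/ 2)%N = 1%N)// !factS fact0; field.
Qed.

(** Parabolic homogeneity: [x] has weight one and [v] has weight two. *)
Lemma hermite_le n s v x : `|x| <= s -> `|v| <= s ^+ 2 ->
  `|hermite n v x| <= n.+1%:R * s ^+ n.
Proof.
move=> xs vs; have s0 : 0 <= s by apply: le_trans xs.
have expc_le m y z : `|y| <= z -> `|expc m y| <= z ^+ m.
  move=> yz; rewrite /expc normrM normfV normrX (ger0_norm (ler0n _ _)).
  rewrite ler_pdivrMr ?ltr0n ?fact_gt0//.
  apply: (@le_trans _ _ (z ^+ m)); first by apply: lerXn2r; rewrite ?nnegrE ?(le_trans _ yz).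
  by rewrite ler_peMr ?exprn_ge0 ?(le_trans _ yz)// ler1n fact_gt0.
apply: le_trans (ler_norm_sum _ _ _) _.
rewrite -[n.+1 in leRHS]card_ord -mulr_natl mulr1 mulr_natl -sumr_const.
apply: ler_sum => i _; have ile : (i <= n)%N by rewrite -ltnS.
have -> : s ^+ n = s ^+ i * s ^+ (n - i) by rewrite -exprD subnKC.
rewrite normrM; apply: ler_pM => //; first exact: expc_le.
case: ifP => [d|_]; last by rewrite normr0 exprn_ge0.
have -> : s ^+ (n - i) = (s ^+ 2) ^+ ((n - i) %/ 2).
  by rewrite -exprM mulnC divnK.
apply: expc_le.
rewrite normrM normrN (@ger0_norm _ 2^-1)//.
by have := normr_ge0 v; lra.
Qed.

Lemma hermite00 n : hermite n.+1 0 0 = 0.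
Proof.
apply/normr0_eq0/le_anti; rewrite normr_ge0 andbT.
have := @hermite_le n.+1 0 0 0; rewrite normr0 !expr0n /= mulr0; exact.
Qed.

Lemma hermite_le_small m n v x : (m <= n)%N -> 0 <= v <= 1 -> `|x| <= 1 ->
  `|hermite n v x| <= n.+1%:R * (`|x| ^+ m + Num.sqrt v ^+ m).
Proof.
move=> mn /andP[v0 v1] x1.
have rv1 : Num.sqrt v <= 1 by rewrite -sqrtr1 ler_sqrt.
have rv0 := sqrtr_ge0 v.
pose s := Num.max `|x| (Num.sqrt v).
have s0 : 0 <= s by rewrite le_max normr_ge0.
have s1 : s <= 1 by rewrite ge_max x1.
apply: (@le_trans _ _ (n.+1%:R * s ^+ n)).
  apply: hermite_le; first by rewrite le_max lexx.
  rewrite ger0_norm// -[leLHS](sqr_sqrtr v0); apply: lerXn2r => //.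
  by rewrite le_max lexx orbT.
rewrite ler_pM2l ?ltr0n//; apply: (@le_trans _ _ (s ^+ m)).
  exact: ler_wiXn2l.
by rewrite /s /Num.max; case: ifP => _; rewrite ?lerDr ?lerDl exprn_ge0.
Qed.

End Hermite.

(** * Dyadic points and continuous functions on the unit interval *)

Section DyadicPoints.
Context (R : realType).

Lemma le_exp2N (m n : nat) : (m <= n)%N -> 2 ^- n <= 2 ^- m :> R.
Proof. by move=> mn; rewrite lef_pV2 ?posrE ?exprn_gt0// ler_eXn2l ?ltr1n. Qed.

Lemma exp2N_gt0 (n : nat) : 0 < 2 ^- n :> R.
Proof. by rewrite invr_gt0 exprn_gt0. Qed.

Lemma exp2N_small (e : R) : 0 < e -> exists n : nat, 2 ^- n <= e.
Proof.
move=> e0; have [n _ /(_ n (leqnn n))] := near_infty_natSinv_lt (PosNum e0).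
move=> /= /ltW h; exists n; apply: le_trans h.
rewrite lef_pV2 ?posrE ?exprn_gt0 ?ltr0Sn// -natrX ler_nat.
exact: ltn_expl.
Qed.

Definition dyad (n k : nat) : R := k%:R / 2 ^+ n.

Lemma dyad0 n : dyad n 0 = 0. Proof. by rewrite /dyad mul0r. Qed.

Lemma dyad_ge0 n k : 0 <= dyad n k.
Proof. by rewrite divr_ge0// exprn_ge0. Qed.

Lemma dyad_le1 n k : (k <= 2 ^ n)%N -> dyad n k <= 1.
Proof. by move=> kn; rewrite ler_pdivrMr ?exprn_gt0// mul1r -natrX ler_nat. Qed.

Lemma dyad_step n k : dyad n k.+1 - dyad n k = 2 ^- n.
Proof. by rewrite /dyad -mulrBl -natr1 addrAC subrr add0r mul1r. Qed.

Lemma dyad_leS n k : dyad n k <= dyad n k.+1.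
Proof. by rewrite -subr_ge0 dyad_step ltW// exp2N_gt0. Qed.

Lemma dyad_refine m n i : (m <= n)%N -> dyad n (i * 2 ^ (n - m)) = dyad m i.
Proof.
move=> mn; rewrite /dyad natrM natrX.
have -> : 2 ^+ n = 2 ^+ m * 2 ^+ (n - m) :> R by rewrite -exprD subnKC.
rewrite invfM mulrACA divff ?mulr1// expf_neq0//.
Qed.

Lemma refine_le m n i : (m <= n)%N -> (i <= 2 ^ m)%N ->
  (i * 2 ^ (n - m) <= 2 ^ n)%N.
Proof.
move=> mn im; rewrite -[X in (_ <= 2 ^ X)%N](subnKC mn) expnD.
by rewrite leq_mul2r im orbT.
Qed.

Lemma dyad_lt n k : dyad n k < dyad n k.+1.
Proof. by rewrite -subr_gt0 dyad_step exp2N_gt0. Qed.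

Lemma dyad_double n k : dyad n.+1 k.*2 = dyad n k.
Proof.
rewrite -(@dyad_refine n n.+1)// subSn// subnn.
by congr (dyad _ _); lia.
Qed.

Lemma dyadic_below (n : nat) (t : R) : 0 <= t <= 1 ->
  exists2 k : nat, (k <= 2 ^ n)%N & dyad n k <= t /\ t - dyad n k <= 2 ^- n.
Proof.
rewrite /dyad => /andP[t0 t1]; pose k := Num.truncn (t * 2 ^+ n).
have p0 : 0 < 2 ^+ n :> R by rewrite exprn_gt0.
have /andP[k1 k2] : k%:R <= t * 2 ^+ n < k.+1%:R.
  by apply: truncn_itv; rewrite mulr_ge0// ltW.
exists k.
  have : k%:R <= (2 ^ n)%:R :> R.
    by rewrite natrX (le_trans k1)// ler_piMl// ltW.
  by rewrite ler_nat.
split; first by rewrite ler_pdivrMr.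
rewrite lerBlDr -[X in X + _]mul1r -mulrDl ler_pdivlMr// ltW//.
by rewrite addrC natr1.
Qed.

End DyadicPoints.

Section UniformContinuity.
Context (R : realType).
Implicit Types (f g : R -> R).

(** Continuity on the unit interval, in the form in which it is used: a bound and
    a modulus of continuity read off on dyadic scales. *)
Definition ucont f :=
  (exists2 M : R, 0 < M & forall t, 0 <= t <= 1 -> `|f t| <= M) /\
  forall e : R, 0 < e -> exists n : nat, forall s u,
    0 <= s -> s <= u -> u <= 1 -> u - s <= 2 ^- n -> `|f u - f s| <= e.

Lemma ucont_cst (c : R) : ucont (fun=> c).
Proof.
split; first by exists (`|c| + 1) => [|? _]; rewrite ?ltr_pwDr// lerDl.
by move=> e e0; exists 0%N => s u *; rewrite subrr normr0 ltW.
Qed.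

Lemma ucontD f g : ucont f -> ucont g -> ucont (fun t => f t + g t).
Proof.
move=> [[M M0 fM] cf] [[N N0 gN] cg]; split.
  exists (M + N); first exact: addr_gt0.
  by move=> t t01; apply: le_trans (ler_normD _ _) (lerD (fM _ t01) (gN _ t01)).
move=> e e0; have e20 : 0 < e / 2 by rewrite divr_gt0.
have [n fn] := cf _ e20; have [p gp] := cg _ e20.
exists (maxn n p) => s u s0 su u1 us.
have -> : f u + g u - (f s + g s) = (f u - f s) + (g u - g s) by ring.
rewrite (splitr e); apply: le_trans (ler_normD _ _) (lerD _ _).
  by apply: fn => //; apply: le_trans us _; apply: le_exp2N; exact: leq_maxl.
by apply: gp => //; apply: le_trans us _; apply: le_exp2N; exact: leq_maxr.
Qed.

Lemma ucontM f g : ucont f -> ucont g -> ucont (fun t => f t * g t).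
Proof.
move=> [[M M0 fM] cf] [[N N0 gN] cg]; split.
  exists (M * N); first exact: mulr_gt0.
  by move=> t t01; rewrite normrM; apply: ler_pM; rewrite ?fM ?gN.
move=> e e0.
have [n fn] := cf (e / 2 / N) ltac:(by rewrite !divr_gt0).
have [p gp] := cg (e / 2 / M) ltac:(by rewrite !divr_gt0).
exists (maxn n p) => s u s0 su u1 us.
have -> : f u * g u - f s * g s = (f u - f s) * g u + f s * (g u - g s) by ring.
have u01 : 0 <= u <= 1 by lra.
have s01 : 0 <= s <= 1 by lra.
rewrite (splitr e); apply: le_trans (ler_normD _ _) (lerD _ _).
  rewrite normrM -[leRHS](@divfK _ N) ?gt_eqF//; apply: ler_pM; rewrite ?gN//.
  by apply: fn => //; apply: le_trans us _; apply: le_exp2N; exact: leq_maxl.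
rewrite normrM mulrC -[leRHS](@divfK _ M) ?gt_eqF//; apply: ler_pM; rewrite ?fM//.
by apply: gp => //; apply: le_trans us _; apply: le_exp2N; exact: leq_maxr.
Qed.

Lemma ucontN f : ucont f -> ucont (fun t => - f t).
Proof.
move=> [[M M0 fM] cf]; split; first by exists M => // t t01; rewrite normrN fM.
move=> e /cf[n fn]; exists n => s u s0 su u1 us.
by rewrite -opprD normrN fn.
Qed.

Lemma ucontX n f : ucont f -> ucont (fun t => f t ^+ n).
Proof.
move=> cf; elim: n => [|n IH]; first exact: ucont_cst.
have -> : (fun t => f t ^+ n.+1) = fun t => f t * f t ^+ n.
  by apply/funext => t; rewrite exprS.
exact: ucontM.
Qed.

Lemma ucont_sum (n : nat) (f : 'I_n -> R -> R) : (forall i, ucont (f i)) ->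
  ucont (fun t => \sum_(i < n) f i t).
Proof.
elim: n f => [|n IH] f cf.
  by under eq_fun do rewrite big_ord0; exact: ucont_cst.
under eq_fun do rewrite big_ord_recl.
by apply: ucontD => //; apply: IH => i; exact: cf.
Qed.

Lemma ucont_hermite n f g : ucont f -> ucont g ->
  ucont (fun t => hermite n (f t) (g t)).
Proof.
move=> cf cg.
have ce k h : ucont h -> ucont (fun t => expc k (h t)).
  by move=> ch; exact: ucontM (ucontX k ch) (ucont_cst _).
apply: (@ucont_sum n.+1 (fun (i : 'I_n.+1) t => expc i (g t) *
  (if (2 %| n - i)%N then expc ((n - i) %/ 2)%N (- f t / 2) else 0))) => i.
apply: (ucontM (ce _ _ cg)); case: (2 %| n - i)%N; last exact: ucont_cst.
by apply: ce; exact: ucontM (ucontN cf) (ucont_cst _).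
Qed.

Lemma ucontV (f : R -> R) (c : R) : 0 < c ->
  (forall t, 0 <= t <= 1 -> c <= f t) -> ucont f -> ucont (fun t => (f t)^-1).
Proof.
move=> c0 fc [_ cf]; split.
  exists c^-1; rewrite ?invr_gt0// => t t01; have ft := fc _ t01.
  have f0 : 0 < f t by exact: lt_le_trans ft.
  by rewrite gtr0_norm ?invr_gt0// lef_pV2.
move=> e e0; have [n fn] := cf (e * c ^+ 2) ltac:(by rewrite mulr_gt0 ?exprn_gt0).
exists n => s u s0 su u1 us.
have cs := fc s ltac:(lra); have cu := fc u ltac:(lra).
have fs0 : 0 < f s by exact: lt_le_trans cs.
have fu0 : 0 < f u by exact: lt_le_trans cu.
have -> : (f u)^-1 - (f s)^-1 = - (f u - f s) / (f s * f u).
  by field; rewrite !gt_eqF.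
rewrite normrM normrN normfV ler_pdivrMr ?normr_gt0 ?mulf_neq0 ?gt_eqF//.
apply: le_trans (fn _ _ s0 su u1 us) _; rewrite ler_pM2l//.
by rewrite gtr0_norm ?mulr_gt0// expr2; apply: ler_pM => //; exact: ltW.
Qed.

Lemma lipschitz_ucont f M : 0 <= M ->
  (forall s u, 0 <= s -> s <= u -> u <= 1 -> `|f u - f s| <= M * (u - s)) ->
  ucont f.
Proof.
move=> M0 fM; split.
  exists (`|f 0| + M + 1); first by rewrite ltr_pwDr// addr_ge0.
  move=> t /andP[t0 t1].
  have -> : f t = f 0 + (f t - f 0) by ring.
  apply: le_trans (ler_normD _ _) _; rewrite -addrA lerD2l.
  apply: le_trans (fM _ _ _ _ _) _ => //.
  have : M * (t - 0) <= M * 1 by rewrite ler_wpM2l// subr0.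
  lra.
move=> e e0; have [n en] := @exp2N_small R (e / (M + 1)) ltac:(by rewrite divr_gt0// ltr_wpDl).
exists n => s u s0 su u1 us.
apply: le_trans (fM _ _ _ _ _) _ => //.
have M1 : 0 < M + 1 by lra.
apply: (@le_trans _ _ ((M + 1) * (u - s))).
  by rewrite ler_wpM2r ?subr_ge0//; lra.
by rewrite -ler_pdivlMl// mulrC (le_trans us).
Qed.

Lemma ucont_eq_dyadic f g : ucont f -> ucont g ->
  (forall n k, (k <= 2 ^ n)%N -> f (dyad R n k) = g (dyad R n k)) ->
  forall t, 0 <= t <= 1 -> f t = g t.
Proof.
move=> cf cg fg t t01.
have ch := ucontD cf (ucontN cg).
apply/eqP; rewrite -subr_eq0 -normr_le0; apply/ler_addgt0Pl => e e0.
rewrite addr0; have [n hn] := ch.2 _ e0.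
have [k kn [kt tk]] := dyadic_below n t01.
have := hn (dyad R n k) t; rewrite (fg _ _ kn) subrr subr0; apply=> //; first exact: dyad_ge0.
by case/andP: t01.
Qed.

Lemma ucont_within f : ucont f -> {within `[0, 1], continuous f}.
Proof.
move=> cf; apply/subspace_continuousP => x /=; rewrite in_itv/= => x01.
apply/cvgrPdist_le => e e0; have [n fn] := cf.2 _ e0.
rewrite near_withinE; near=> y; rewrite /= in_itv/= => y01.
have xy : `|x - y| < 2 ^- n.
  by near: y; apply: (@cvgr_dist_lt _ _ _ _ _ id) => //; rewrite exp2N_gt0.
have [xley|/ltW ylex] := leP x y.
  rewrite distrC; apply: fn => //; try lra.
  by apply: le_trans (ltW xy); rewrite distrC ler_norm.
by apply: fn => //; try lra; apply: le_trans (ltW xy); rewrite ler_norm.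
Unshelve. all: by end_near. Qed.

Lemma within_ucont f : {within `[0, +oo[, continuous f} -> ucont f.
Proof.
move=> cf0; have cf : {within `[0, 1], continuous f}.
  by apply: continuous_subspaceW cf0 => x /=; rewrite !in_itv/= => /andP[-> _].
split.
  have [M [_ fM]] := compact_bounded (continuous_compact cf (@segment_compact _ 0 1)).
  exists (`|M| + 1) => [|t t01]; first by rewrite ltr_pwDr.
  apply: (fM (`|M| + 1)); last by exists t.
  by rewrite (le_lt_trans (ler_norm M))// ltrDl.
move=> e e0; have e20 : 0 < e / 2 by rewrite divr_gt0.
(* a radius that is uniform over the compact interval *)
pose P (n : nat) (x : R) := forall y, 0 <= y <= 1 -> `|x - y| <= 2 ^- n ->
  `|f x - f y| <= e.
have : \forall n \near \oo, `[0, 1] `<=` P n.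
  have /compact_near_coveringP/near_covering_withinP cov := @segment_compact R 0 1.
  apply: (cov nat (nbhs \oo) P) => x; rewrite /= in_itv/= => x01.
  have /subspace_continuousP/(_ x) := cf; rewrite /= in_itv/= => /(_ x01).
  move=> /cvgrPdist_le/(_ _ e20); rewrite /within/= => -[d /= d0 fd].
  have [m dm] := @exp2N_small R (d / 2 / 2) ltac:(by rewrite !divr_gt0).
  exists (ball x (d / 2), [set n | (m <= n)%N]) => /=.
    split; first by apply: nbhsx_ballx; rewrite divr_gt0.
    by exists m.
  move=> [y n]/= [xy mn]; rewrite in_itv/= => y01 z z01 yz.
  rewrite /ball/= in xy.
  have nm := le_exp2N R mn.
  have -> : f y - f z = (f x - f z) - (f x - f y) by ring.
  rewrite (splitr e); apply: le_trans (ler_normB _ _) (lerD _ _).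
    apply: fd; rewrite ?in_itv//= /ball/=.
    have -> : x - z = (x - y) + (y - z) by ring.
    by apply: le_lt_trans (ler_normD _ _) _; lra.
  by apply: fd; rewrite ?in_itv//= /ball/=; lra.
move=> [n _ /(_ n (leqnn n)) Pn]; exists n => s u s0 su u1 us.
have su' : `|u - s| <= 2 ^- n by rewrite ger0_norm// subr_ge0.
by apply: Pn => //=; rewrite ?in_itv/=; lra.
Qed.

End UniformContinuity.

Section IntegralOfContinuous.
Context (R : realType).
Implicit Types (f : R -> R).
Local Notation mu := (@lebesgue_measure R).

Lemma ucont_integrable f (a b : R) : 0 <= a -> b <= 1 -> ucont f ->
  mu.-integrable `[a, b] (EFin \o f).
Proof.
move=> a0 b1 cf; apply: continuous_compact_integrable.
  exact: segment_compact.
apply: continuous_subspaceW (ucont_within cf) => x /=.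
by rewrite !in_itv/= => /andP[? ?]; apply/andP; split; lra.
Qed.

Lemma Rintegral_at0 f : \int[mu]_(r in `[0, 0]) f r = 0.
Proof. by rewrite set_itv1 Rintegral_set1. Qed.

Lemma Rintegral_increment f (s u c e : R) : ucont f ->
  0 <= s -> s <= u -> u <= 1 ->
  (forall r, s <= r <= u -> `|f r - c| <= e) ->
  `|\int[mu]_(r in `[0, u]) f r - \int[mu]_(r in `[0, s]) f r - c * (u - s)|
    <= e * (u - s).
Proof.
move=> cf s0 su u1 fc.
rewrite Rintegral_itvB ?bnd_simp//; last by apply: ucont_integrable.
have fsu : mu.-integrable `[s, u] (EFin \o f) by exact: ucont_integrable.
rewrite Rintegral_itv_obnd_cbnd; last first.
  by apply: integrableS fsu => // x /=; rewrite !in_itv/= => /andP[/ltW -> ->].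
have muE : fine (mu `[s, u]) = u - s.
  rewrite lebesgue_measure_itv/= lte_fin; case: ltP => //= us.
  by apply/esym/eqP; rewrite subr_eq0 eq_le us su.
have icst k : mu.-integrable `[s, u] (EFin \o (fun=> k)).
  by apply: ucont_integrable => //; exact: ucont_cst.
have cstE k : \int[mu]_(r in `[s, u]) k = k * (u - s).
  by rewrite Rintegral_cst// muE.
rewrite -[X in _ - X]cstE -RintegralB//.
have fcI : mu.-integrable `[s, u] (EFin \o (fun r => f r - c)).
  by apply: ucont_integrable => //; apply: ucontD => //; exact: ucont_cst.
rewrite -cstE; apply: le_trans (le_normr_Rintegral _ _) _ => //.
by apply: le_Rintegral => //; have /integrable_norm := fcI.
Qed.

Lemma Rintegral_bound f (t M : R) : ucont f -> 0 <= t <= 1 ->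
  (forall r, 0 <= r <= t -> `|f r| <= M) ->
  `|\int[mu]_(r in `[0, t]) f r| <= M * t.
Proof.
move=> cf /andP[t0 t1] fM.
have := Rintegral_increment cf (lexx _) t0 t1 (c := 0) (e := M).
rewrite Rintegral_at0 mul0r !subr0; apply=> r rt; rewrite subr0.
exact: fM.
Qed.

End IntegralOfContinuous.

(** * Expansions of iterated integrals along a path *)

Section Towers.
Context (R : realType).
Implicit Types (b A f g : R -> R) (G : nat -> R -> R).

(** A common axiomatization of the processes
    [t |-> \int_0^t g r * hermite a (A t - A r) (b t - b r) dr] and
    [t |-> hermite a (A t) (b t)]: the addition theorem expresses level [a] at
    time [u] through the levels up to [a] at time [s], up to the contribution of
    the integral over [[s, u]], which is of order [u - s], and [o(u - s)] above
    the bottom level. *)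
Record tower b A G : Prop := Tower {
  tower_ucont : forall a, ucont (G a);
  tower_lip : forall a, exists2 M : R, 0 <= M & forall s u,
    0 <= s -> s <= u -> u <= 1 ->
    `|G a u - \sum_(j < a.+1) hermite j (A u - A s) (b u - b s) * G (a - j)%N s|
      <= M * (u - s);
  tower_expansion : forall a (e : R), 0 < e -> exists n : nat, forall s u,
    0 <= s -> s <= u -> u <= 1 -> u - s <= 2 ^- n ->
    `|G a.+1 u -
      \sum_(j < a.+2) hermite j (A u - A s) (b u - b s) * G (a.+1 - j)%N s|
      <= e * (u - s);
  tower_at0 : forall a, G a.+1 0 = 0
}.

(** Extending by 0 below the bottom level makes the expansions of the first
    levels instances of the general one. *)
Definition descend G a j (t : R) : R := if (j <= a)%N then G (a - j)%N t else 0.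

Lemma tower_bounded b A G a : tower b A G -> exists2 M : R, 0 <= M &
  forall j t, 0 <= t <= 1 -> `|descend G a j t| <= M.
Proof.
move=> tG; have [M M0 GM] : exists2 M : R, 0 <= M & forall i t, (i <= a)%N ->
    0 <= t <= 1 -> `|G i t| <= M.
  elim: a => [|a [M M0 IH]].
    have [[M M0 GM] _] := tower_ucont tG 0.
    by exists M => [|i t]; [exact: ltW|rewrite leqn0 => /eqP->; exact: GM].
  have [[N N0 GN] _] := tower_ucont tG a.+1.
  exists (M + N) => [|i t]; first by rewrite addr_ge0// ltW.
  rewrite leq_eqVlt => /orP[/eqP->|ia] t01.
    by apply: le_trans (GN _ t01) _; rewrite lerDr.
  by apply: le_trans (IH _ _ _ t01) _ => //; rewrite lerDl ltW.
exists M => // j t t01; rewrite /descend; case: ifP => _; last by rewrite normr0.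
by apply: GM => //; exact: leq_subr.
Qed.

Lemma descend_sum G a (h : nat -> R) t :
  \sum_(j < a.+1) h j * G (a - j)%N t = \sum_(j < a.+3) h j * descend G a j t.
Proof.
rewrite [RHS]big_ord_recr [in RHS]big_ord_recr /= /descend !ifF; try lia.
rewrite !mulr0 !addr0; apply: eq_bigr => i _.
by rewrite ifT// -ltnS.
Qed.

Lemma hermite_series_tail m N (g : nat -> R) (M v x : R) :
  0 <= v <= 1 -> `|x| <= 1 -> (forall j, `|g j| <= M) ->
  `|\sum_(j < N) hermite (m + j) v x * g j| <=
    (\sum_(j < N) (m + j).+1%:R) * M * (`|x| ^+ m + Num.sqrt v ^+ m).
Proof.
move=> v01 x1 gM; apply: le_trans (ler_norm_sum _ _ _) _.
rewrite -mulrA mulr_suml; apply: ler_sum => j _; rewrite normrM.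
rewrite mulrCA [leRHS]mulrC; apply: ler_pM => //.
by apply: hermite_le_small => //; exact: leq_addr.
Qed.

Lemma hermite_series2 N (g : nat -> R) (M v x : R) :
  0 <= v <= 1 -> `|x| <= 1 -> (forall j, `|g j| <= M) ->
  `|\sum_(j < N.+2) hermite j v x * g j - (g 0%N + x * g 1%N)| <=
    (\sum_(j < N) (2 + j).+1%:R) * M * (`|x| ^+ 2 + Num.sqrt v ^+ 2).
Proof.
move=> v01 x1 gM; rewrite !big_ord_recl /= hermite0 hermite1 /bump /=.
set S := \sum_(j < N) _; rewrite (_ : _ - _ = S); last by ring.
exact: (@hermite_series_tail 2 N (fun j => g (2 + j)%N) M v x v01 x1).
Qed.

Lemma hermite_series3 N (g : nat -> R) (M v x : R) :
  0 <= v <= 1 -> `|x| <= 1 -> (forall j, `|g j| <= M) ->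
  `|\sum_(j < N.+3) hermite j v x * g j
    - (g 0%N + x * g 1%N + (x ^+ 2 - v) / 2 * g 2%N)| <=
    (\sum_(j < N) (3 + j).+1%:R) * M * (`|x| ^+ 3 + Num.sqrt v ^+ 3).
Proof.
move=> v01 x1 gM.
rewrite !big_ord_recl /= hermite0 hermite1 hermite2 /bump /=.
set S := \sum_(j < N) _; rewrite (_ : _ - _ = S); last by ring.
exact: (@hermite_series_tail 3 N (fun j => g (3 + j)%N) M v x v01 x1).
Qed.

(** One step of the non-anticipating sum of [G a] against [b]: the terms of order
    one and two of the expansion of [G a.+1] are singled out, and the others are
    cubic in [b] or negligible with respect to [A] and to time. *)
Lemma Ito_step b A G a : ucont b -> ucont A ->
  (forall s u, 0 <= s -> s <= u -> u <= 1 -> A s <= A u) ->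
  tower b A G -> exists2 K : R, 0 <= K & forall e : R, 0 < e ->
  exists n : nat, forall s u, 0 <= s -> s <= u -> u <= 1 -> u - s <= 2 ^- n ->
  `|G a s * (b u - b s) - (G a.+1 u - G a.+1 s)
    + descend G a 1 s * (((b u - b s) ^+ 2 - (A u - A s)) / 2)| <=
  K * `|b u - b s| ^+ 3 + e * ((A u - A s) + (u - s)).
Proof.
move=> cb cA mA tG; have [M M0 GM] := tower_bounded a.+1 tG.
set K := (\sum_(j < a.+1) (3 + j).+1%:R) * M.
have K0 : 0 <= K by rewrite mulr_ge0// sumr_ge0.
exists K => // e e0.
have [n1 bn] := cb.2 1 ltr01.
pose c := Num.min 1 ((e / (K + 1)) ^+ 2).
have c0 : 0 < c by rewrite lt_min ltr01 exprn_gt0// divr_gt0// ltr_wpDl.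
have [n2 An] := cA.2 _ c0.
have [n3 Gn] := tower_expansion tG a e0.
exists (maxn n1 (maxn n2 n3)) => s u s0 su u1 us.
have x1 : `|b u - b s| <= 1.
  by apply: bn => //; apply: le_trans us _; apply: le_exp2N; lia.
have vc : `|A u - A s| <= c.
  by apply: An => //; apply: le_trans us _; apply: le_exp2N; lia.
have {Gn}En := Gn s u s0 su u1 ltac:(by apply: le_trans us _; apply: le_exp2N; lia).
have v0 : 0 <= A u - A s by rewrite subr_ge0 mA.
rewrite ger0_norm// in vc.
have v01 : 0 <= A u - A s <= 1 by rewrite v0 (le_trans vc)// ge_min lexx.
have s01 : 0 <= s <= 1 by lra.
have sv : K * Num.sqrt (A u - A s) <= e.
  apply: (@le_trans _ _ (K * (e / (K + 1)))).
    rewrite ler_wpM2l//.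
    have ep : 0 <= e / (K + 1) by rewrite ltW// divr_gt0// ltr_wpDl.
    rewrite -(ger0_norm ep) -sqrtr_sqr ler_sqrt; last by rewrite sqr_ge0.
    by rewrite (le_trans vc)// ge_min lexx orbT.
  have K1 : 0 < K + 1 by lra.
  by rewrite mulrA ler_pdivrMr// mulrC ler_wpM2l ?(ltW e0)//; lra.
rewrite (descend_sum G a.+1 (fun j => hermite j (A u - A s) (b u - b s))) in En.
have := @hermite_series3 a.+1 (fun j => descend G a.+1 j s) M _ _ v01 x1
  (fun j => GM j _ s01).
rewrite -/K /descend /= subn0 subSS subn0 subSS => Sn.
set S := \sum_(j < _) _ in En Sn.
set x := b u - b s in x1 Sn *; set v := A u - A s in v0 v01 sv Sn *.
set D := (if (1 <= a)%N then _ else _) in Sn *.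
have -> : G a s * x - (G a.+1 u - G a.+1 s) + D * ((x ^+ 2 - v) / 2) =
  - ((S - (G a.+1 s + x * G a s + (x ^+ 2 - v) / 2 * D)) + (G a.+1 u - S)) by ring.
rewrite normrN; apply: le_trans (ler_normD _ _) _.
have : K * Num.sqrt v ^+ 3 <= e * v.
  by rewrite exprS sqr_sqrtr// mulrA ler_wpM2r.
lra.
Qed.

(** Averaging the endpoints adds half of the product of the increments of [G a]
    and [b], which cancels the second-order term of the expansion; hence no
    bracket occurs. *)
Lemma Stratonovich_step b G a : ucont b -> tower b (fun=> 0) G ->
  exists2 K : R, 0 <= K & forall e : R, 0 < e ->
  exists n : nat, forall s u, 0 <= s -> s <= u -> u <= 1 -> u - s <= 2 ^- n ->
  `|(G a s + G a u) / 2 * (b u - b s) - (G a.+1 u - G a.+1 s)| <=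
  K * `|b u - b s| ^+ 3 + e * (u - s).
Proof.
move=> cb tG; have c0 := @ucont_cst R 0.
have [K K0 HK] := Ito_step a cb c0 (fun _ _ _ _ _ => lexx _) tG.
have [L L0 HL] := tower_lip tG a.
have [M M0 GM] := tower_bounded a tG.
set N := (\sum_(j < a.+1) (2 + j).+1%:R) * M.
have N0 : 0 <= N by rewrite mulr_ge0// sumr_ge0.
exists (K + N) => [|e e0]; first exact: addr_ge0.
have e2 : 0 < e / 2 by rewrite divr_gt0.
have [n1 Hn1] := HK _ e2.
have [n2 bn2] := cb.2 _ ltr01.
have [n3 bn3] := cb.2 (e / 2 / (L + 1)) ltac:(by rewrite divr_gt0// ltr_wpDl).
exists (maxn n1 (maxn n2 n3)) => s u s0 su u1 us.
have {Hn1} := Hn1 s u s0 su u1 ltac:(by apply: le_trans us _; apply: le_exp2N; lia).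
have x1 : `|b u - b s| <= 1.
  by apply: bn2 => //; apply: le_trans us _; apply: le_exp2N; lia.
have xe : L * `|b u - b s| <= e / 2.
  apply: (@le_trans _ _ ((L + 1) * (e / 2 / (L + 1)))).
    apply: ler_pM => //; first by rewrite lerDl.
    by apply: bn3 => //; apply: le_trans us _; apply: le_exp2N; lia.
  by rewrite mulrCA divff ?mulr1// gt_eqF// ltr_wpDl.
have {HL}Ln := HL s u s0 su u1.
have s01 : 0 <= s <= 1 by lra.
rewrite subrr (descend_sum G a (fun j => hermite j 0 (b u - b s))) in Ln *.
have := @hermite_series2 a.+1 (fun j => descend G a j s) M 0 _ _ x1
  (fun j => GM j _ s01).
rewrite -/N lexx ler01 => /(_ isT); rewrite sqrtr0 expr0n /= addr0.
rewrite {2}/descend /= subn0.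
set S := \sum_(j < _) _ in Ln *; set x := b u - b s in x1 xe Ln *.
set D := descend G a 1 s => Sn Kn; rewrite subr0 add0r in Kn.
have -> : (G a s + G a u) / 2 * x - (G a.+1 u - G a.+1 s) =
   (G a s * x - (G a.+1 u - G a.+1 s) + D * (x ^+ 2 / 2)) +
   x * ((S - (G a s + x * D)) + (G a u - S)) / 2 by field.
apply: le_trans (ler_normD _ _) _.
rewrite [`|x * _ / 2|]normrM [`|x * _|]normrM (@ger0_norm _ 2^-1)//.
have x0 := normr_ge0 x.
have T1 : `|x| * `|S - (G a s + x * D) + (G a u - S)| <=
   `|x| * (N * `|x| ^+ 2 + L * (u - s)).
  by rewrite ler_wpM2l//; apply: le_trans (ler_normD _ _) (lerD Sn Ln).
have T2 : `|x| * (L * (u - s)) <= e / 2 * (u - s).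
  by rewrite mulrA (mulrC `|x|) ler_wpM2r// subr_ge0.
have T3 : 0 <= N * `|x| ^+ 3 by rewrite mulr_ge0// exprn_ge0.
have T4 : 0 <= e / 2 * (u - s) by rewrite mulr_ge0 ?subr_ge0// ltW.
have T5 : `|x| * (N * `|x| ^+ 2) = N * `|x| ^+ 3 by ring.
rewrite mulrDr T5 in T1; lra.
Qed.

End Towers.

(** * Convergence of dyadic Riemann sums *)

Section DyadicSums.
Context (R : realType).
Implicit Types (f : R -> R).
Local Notation dyad := (dyad R).

Lemma sum_widen_le (F : nat -> R) p q : (forall k, 0 <= F k) -> (p <= q)%N ->
  \sum_(k < p) F k <= \sum_(k < q) F k.
Proof.
move=> F0 pq; rewrite -(subnKC pq) big_split_ord /= lerDl.
by apply: sumr_ge0.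
Qed.

Lemma sum_blocks (F : nat -> R) i p :
  \sum_(k < i * p) F k = \sum_(i' < i) \sum_(j < p) F (i' * p + j)%N.
Proof.
elim: i => [|i IH]; first by rewrite mul0n !big_ord0.
rewrite big_ord_recr /= -IH; have -> : (i.+1 * p = i * p + p)%N by lia.
by rewrite big_split_ord.
Qed.

Lemma dyad_telescope f n N :
  \sum_(k < N) (f (dyad n k.+1) - f (dyad n k)) = f (dyad n N) - f 0.
Proof.
elim: N => [|N IH]; first by rewrite big_ord0 dyad0 subrr.
by rewrite big_ord_recr /= IH; ring.
Qed.

Lemma cvg_sum0 N (u : nat -> nat -> R) :
  (forall i, (i < N)%N -> u i @ \oo --> 0) ->
  (fun l => \sum_(i < N) u i l) @ \oo --> 0.
Proof.
elim: N => [|N IH] u0.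
  by under eq_fun do rewrite big_ord0; exact: cvg_cst.
under eq_fun do rewrite big_ord_recr /=.
have := cvgD (IH (fun i iN => u0 i (ltnW iN))) (u0 N (leqnn _)).
by rewrite addr0; exact.
Qed.

(** Weak convergence: if the masses of dyadic intervals tend to 0 and the total
    variation stays bounded, a continuous weight can be frozen on a coarser
    grid, at the cost of its oscillation there. *)
Lemma weighted_sum_cvg0 (c : nat -> nat -> R) (nl : nat -> nat) (M : R) f :
  (forall l, (l <= nl l)%N) -> 0 <= M ->
  (forall l, \sum_(k < 2 ^ nl l) `|c (nl l) k| <= M) ->
  (forall m i, (i <= 2 ^ m)%N ->
    (fun l => \sum_(k < i * 2 ^ (nl l - m)) c (nl l) k) @ \oo --> 0) ->
  ucont f -> forall m i, (i <= 2 ^ m)%N ->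
  (fun l => \sum_(k < i * 2 ^ (nl l - m)) f (dyad (nl l) k) * c (nl l) k)
    @ \oo --> 0.
Proof.
move=> nlP M0 cM c0 cf m i im; apply/cvgr0Pnorm_le => e e0.
have [p0 fp0] := cf.2 (e / 2 / (M + 1)) ltac:(by rewrite !divr_gt0// ltr_wpDl).
pose p := maxn m p0; pose i2 := (i * 2 ^ (p - m))%N.
have mp : (m <= p)%N by exact: leq_maxl.
have i2p : (i2 <= 2 ^ p)%N by exact: refine_le.
pose D i' l := \sum_(k < i' * 2 ^ (nl l - p)) c (nl l) k.
have v0 : (fun l => \sum_(i' < i2) `|f (dyad p i')| * `|D i'.+1 l - D i' l|)
    @ \oo --> 0.
  apply: (cvg_sum0 (u := fun i' l => `|f (dyad p i')| * `|D i'.+1 l - D i' l|)).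
  move=> j ji.
  have : (fun l => D j.+1 l - D j l) @ \oo --> 0 - 0.
    by apply: cvgB; apply: c0; [exact: leq_trans i2p|exact/ltnW/(leq_trans ji)].
  rewrite subrr => /cvg_norm; rewrite normr0.
  by move=> /(cvgM (cvg_cst `|f (dyad p j)|)); rewrite mulr0; exact.
have /cvgr0Pnorm_le/(_ (e / 2)) := v0.
move=> /(_ ltac:(by rewrite divr_gt0)) v0e.
near=> l.
have pl : (p <= nl l)%N.
  apply: leq_trans (nlP l); near: l; exact: nbhs_infty_ge.
have -> : (i * 2 ^ (nl l - m) = i2 * 2 ^ (nl l - p))%N.
  rewrite /i2 -mulnA -expnD; congr (_ * 2 ^ _)%N; lia.
rewrite (sum_blocks (fun k => f (dyad (nl l) k) * c (nl l) k)).
set n := nl l in pl *; set q := (n - p)%N.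
have -> : \sum_(i' < i2) \sum_(j < 2 ^ q)
    f (dyad n (i' * 2 ^ q + j)) * c n (i' * 2 ^ q + j)%N =
  \sum_(i' < i2) f (dyad p i') * (D i'.+1 l - D i' l) +
  \sum_(i' < i2) \sum_(j < 2 ^ q)
    (f (dyad n (i' * 2 ^ q + j)) - f (dyad p i')) * c n (i' * 2 ^ q + j)%N.
  rewrite -big_split; apply: eq_bigr => i' _ /=.
  have -> : D i'.+1 l - D i' l = \sum_(j < 2 ^ q) c n (i' * 2 ^ q + j)%N.
    have -> : D i'.+1 l = D i' l + \sum_(j < 2 ^ q) c n (i' * 2 ^ q + j)%N.
      rewrite /D -/n -/q; have -> : (i'.+1 * 2 ^ q = i' * 2 ^ q + 2 ^ q)%N by lia.
      by rewrite big_split_ord.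
    by rewrite addrC addKr.
  by rewrite mulr_sumr -big_split; apply: eq_bigr => j _ /=; ring.
rewrite (splitr e); apply: le_trans (ler_normD _ _) (lerD _ _).
  apply: le_trans (ler_norm_sum _ _ _) _.
  have : `|\sum_(i' < i2) `|f (dyad p i')| * `|D i'.+1 l - D i' l| | <= e / 2.
    by near: l.
  apply: le_trans; rewrite ger0_norm; last by apply: sumr_ge0 => *; rewrite mulr_ge0.
  by apply: ler_sum => j _; rewrite normrM.
apply: (@le_trans _ _ (e / 2 / (M + 1) * \sum_(k < i2 * 2 ^ q) `|c n k|)).
  rewrite (sum_blocks (fun k => `|c n k|)) mulr_sumr.
  apply: le_trans (ler_norm_sum _ _ _) _; apply: ler_sum => i' _.
  rewrite mulr_sumr.
  apply: le_trans (ler_norm_sum _ _ _) _; apply: ler_sum => j _.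
  rewrite normrM ler_wpM2r//.
  have jq := ltn_ord j; have i'p : (i' < 2 ^ p)%N by apply: leq_trans i2p.
  have pq : (2 ^ n = 2 ^ p * 2 ^ q)%N by rewrite -expnD subnKC.
  have q0 : 0 < 2 ^+ n :> R by rewrite exprn_gt0.
  rewrite -(@dyad_refine R p n)//.
  apply: fp0; first exact: dyad_ge0.
  - by rewrite ler_pM2r ?invr_gt0// ler_nat leq_addr.
  - apply: dyad_le1; rewrite pq.
    by apply: leq_trans (_ : i'.+1 * 2 ^ q <= _)%N; [lia|rewrite leq_mul2r i'p orbT].
  - rewrite /dyad -mulrBl natrD [X in X / _]addrC addKr.
    apply: (@le_trans _ _ (2 ^- p)); last by apply: le_exp2N; exact: leq_maxr.
    have pqR : 2 ^+ n = 2 ^+ p * 2 ^+ q :> R by rewrite -exprD subnKC.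
    by rewrite ler_pdivrMr// pqR mulKf ?expf_neq0// -natrX ler_nat ltnW.
apply: (@le_trans _ _ (e / 2 / (M + 1) * M)).
  have ep : 0 <= e / 2 / (M + 1) by rewrite ltW// !divr_gt0// ltr_wpDl.
  apply: ler_wpM2l => //; apply: le_trans (cM l).
  apply: (@sum_widen_le (fun k => `|c n k|)) => //.
  by rewrite /i2 /n; apply: refine_le.
rewrite -mulrA ger_pMr ?divr_gt0// mulrC ler_pdivrMr ?ltr_wpDl//; lra.
Unshelve. all: by end_near. Qed.

End DyadicSums.

Section RiemannSums.
Context (R : realType).
Implicit Types (b A f g y : R -> R) (G : nat -> R -> R).

Definition dyadic_riemann_sum (sense : integration_sense) y b n N : R :=
  \sum_(k < N) tag_value sense y (dyad R n k) (dyad R n k.+1) *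
    (b (dyad R n k.+1) - b (dyad R n k)).

(** [A] stands for the bracket of the path [b] that the chosen integral sees:
    the quadratic variation for left-endpoint sums, and nothing for trapezoidal
    sums, which obey the classical chain rule.  The partitions used are the
    dyadic ones of levels [nl l]. *)
Record driving_path (sense : integration_sense) b A (nl : nat -> nat) : Prop :=
  DrivingPath {
  driving_path_ucont : ucont b;
  driving_bracket_ucont : ucont A;
  driving_path_at0 : b 0 = 0;
  driving_bracket_at0 : A 0 = 0;
  driving_bracket_mono : forall s u, 0 <= s -> s <= u -> u <= 1 -> A s <= A u;
  driving_level : forall l, (l <= nl l)%N;
  driving_cubic : (fun n => \sum_(k < 2 ^ n)
    `|b (dyad R n k.+1) - b (dyad R n k)| ^+ 3) @ \oo --> 0;
  driving_quadratic : match sense with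
    | Ito => forall m i, (i <= 2 ^ m)%N ->
      (fun l => \sum_(k < i * 2 ^ (nl l - m))
         (b (dyad R (nl l) k.+1) - b (dyad R (nl l) k)) ^+ 2) @ \oo
      --> A (dyad R m i)
    | Stratonovich => A = fun=> 0
    end }.

Lemma tower_step sense b A nl G a : driving_path sense b A nl -> tower b A G ->
  exists2 K : R, 0 <= K & forall e : R, 0 < e ->
  exists n : nat, forall s u, 0 <= s -> s <= u -> u <= 1 -> u - s <= 2 ^- n ->
  `|tag_value sense (G a) s u * (b u - b s) - (G a.+1 u - G a.+1 s)
    + (if sense is Ito then
         descend G a 1 s * (((b u - b s) ^+ 2 - (A u - A s)) / 2) else 0)| <=
  K * `|b u - b s| ^+ 3 + e * ((A u - A s) + (u - s)).
Proof.
case: sense => -[cb cA _ _ mA _ _ qv] tG.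
  exact: Ito_step.
rewrite qv in tG.
have [K K0 HK] := Stratonovich_step a cb tG.
exists K => // e e0; have [n Hn] := HK _ e0; exists n => s u s0 su u1 us.
by rewrite qv subrr add0r addr0; exact: Hn.
Qed.

Lemma quadratic_defect_cvg0 b A nl f : driving_path Ito b A nl -> ucont f ->
  forall m i, (i <= 2 ^ m)%N ->
  (fun l => \sum_(k < i * 2 ^ (nl l - m)) f (dyad R (nl l) k) *
    (((b (dyad R (nl l) k.+1) - b (dyad R (nl l) k)) ^+ 2
      - (A (dyad R (nl l) k.+1) - A (dyad R (nl l) k))) / 2)) @ \oo --> 0.
Proof.
move=> [cb cA b0 A0 mA nlP _ qv] cf.
pose c n k := ((b (dyad R n k.+1) - b (dyad R n k)) ^+ 2
      - (A (dyad R n k.+1) - A (dyad R n k))) / 2.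
have mAk n k : (k < 2 ^ n)%N -> A (dyad R n k) <= A (dyad R n k.+1).
  by move=> kn; apply: mA; rewrite ?dyad_ge0 ?dyad_leS// dyad_le1.
have qv1 := qv 0%N 1%N (leqnn _).
have [M M0 qM] : exists2 M : R, 0 <= M & forall l, \sum_(k < 2 ^ nl l)
    (b (dyad R (nl l) k.+1) - b (dyad R (nl l) k)) ^+ 2 <= M.
  have /cvg_ex/cvg_seq_bounded[M [_ HM]] : exists z : R, (fun l =>
      \sum_(k < 1 * 2 ^ (nl l - 0))
         (b (dyad R (nl l) k.+1) - b (dyad R (nl l) k)) ^+ 2) @ \oo --> z.
    by exists (A (dyad R 0 1)).
  exists (`|M| + 1) => [|l]; first by rewrite addr_ge0.
  have := HM (`|M| + 1) ltac:(by rewrite (le_lt_trans (ler_norm M))// ltrDl) l I.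
  by rewrite /= mul1n subn0 => /(le_trans (ler_norm _)).
have [[N N0 AN] _] := cA.
apply: (@weighted_sum_cvg0 R c nl (M + N)) => //.
- by rewrite addr_ge0// ltW.
- move=> l; apply: (@le_trans _ _ (\sum_(k < 2 ^ nl l)
    ((b (dyad R (nl l) k.+1) - b (dyad R (nl l) k)) ^+ 2 +
     (A (dyad R (nl l) k.+1) - A (dyad R (nl l) k))))).
    apply: ler_sum => k _; rewrite /c.
    have q0 := sqr_ge0 (b (dyad R (nl l) k.+1) - b (dyad R (nl l) k)).
    have A'0 := mAk _ _ (ltn_ord k).
    by rewrite ler_norml; apply/andP; split; lra.
  rewrite big_split /= lerD ?qM//.
  rewrite (dyad_telescope A) A0 subr0.
  apply: le_trans (ler_norm _) (AN _ _).
  by rewrite dyad_ge0 dyad_le1.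
- move=> m i im; rewrite /c.
  have : (fun l => (\sum_(k < i * 2 ^ (nl l - m))
     (b (dyad R (nl l) k.+1) - b (dyad R (nl l) k)) ^+ 2
     - A (dyad R m i)) / 2) @ \oo --> (A (dyad R m i) - A (dyad R m i)) / 2.
    apply: cvgM; last exact: cvg_cst.
    by apply: cvgB; [exact: qv|exact: cvg_cst].
  rewrite subrr mul0r; apply: cvg_trans; apply: near_eq_cvg.
  near=> l; rewrite -mulr_suml sumrB; congr ((_ - _) / 2).
  rewrite (dyad_telescope A) A0 subr0 dyad_refine//.
  apply: leq_trans (nlP l); near: l; exact: nbhs_infty_ge.
Unshelve. all: by end_near. Qed.

(** The Riemann sums of one member of a tower converge to the next one: summing
    the expansion of the latter over a partition leaves cubic terms, which
    vanish, and the defect of the quadratic variation. *)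
Lemma tower_riemann_sum sense b A nl G a : driving_path sense b A nl ->
  tower b A G -> forall m i, (i <= 2 ^ m)%N ->
  (fun l => dyadic_riemann_sum sense (G a) b (nl l) (i * 2 ^ (nl l - m))) @ \oo
  --> G a.+1 (dyad R m i).
Proof.
move=> dp tG m i im; have [K K0 HK] := tower_step a dp tG.
have [cb cA b0 A0 mA nlP cub qv] := dp.
pose D f n k := f (dyad R n k.+1) - f (dyad R n k).
pose corr n k := if sense is Ito then
  descend G a 1 (dyad R n k) * ((D b n k ^+ 2 - D A n k) / 2) else 0.
pose S l := \sum_(k < i * 2 ^ (nl l - m)) corr (nl l) k.
have S0 : S @ \oo --> 0.
  rewrite /S /corr; case: sense {HK S corr} dp qv => dp qv.
    have cd : ucont (descend G a 1).
      rewrite /descend; case: (1 <= a)%N; last exact: ucont_cst.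
      exact: tower_ucont tG _.
    exact: (quadratic_defect_cvg0 dp cd im).
  by under eq_fun do rewrite big1//; exact: cvg_cst.
have mAk n k : (k < 2 ^ n)%N -> 0 <= D A n k.
  by move=> kn; rewrite subr_ge0 mA ?dyad_ge0 ?dyad_leS// dyad_le1.
have [[N N0 AN] _] := cA.
suff H : (fun l => dyadic_riemann_sum sense (G a) b (nl l) (i * 2 ^ (nl l - m))
    - G a.+1 (dyad R m i) + S l) @ \oo --> 0.
  have := cvgD (cvgB H S0) (@cvg_cst _ (G a.+1 (dyad R m i)) _ \oo _).
  rewrite subr0 add0r => h; apply: cvg_trans (h _ _ _); apply: near_eq_cvg.
  by near=> l; rewrite !fctE; ring.
apply/cvgr0Pnorm_le => e e0.
have e1 : 0 < e / 2 / (N + 1) by rewrite !divr_gt0// ltr_pwDr// ltW.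
have [n0 Hn0] := HK _ e1.
have e2 : 0 < e / 2 / (K + 1) by rewrite !divr_gt0// ltr_wpDl.
have /cvgr0Pnorm_le/(_ _ e2)[n1 _ Hn1] := cub.
near=> l.
have ln : (maxn m (maxn n0 n1) <= nl l)%N.
  apply: leq_trans (nlP l); near: l; exact: nbhs_infty_ge.
move: ln; rewrite !geq_max => /andP[mn /andP[n0n n1n]].
set n := nl l in mn n0n n1n *.
have pn : (i * 2 ^ (n - m) <= 2 ^ n)%N by exact: refine_le.
set p := (i * 2 ^ (n - m))%N in pn *.
have -> : G a.+1 (dyad R m i) = \sum_(k < p) D (G a.+1) n k.
  by rewrite (dyad_telescope (G a.+1)) (tower_at0 tG) subr0 dyad_refine.
rewrite /dyadic_riemann_sum /S -sumrB -big_split /=.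
have bound k : (k < 2 ^ n)%N ->
  `|tag_value sense (G a) (dyad R n k) (dyad R n k.+1) * D b n k
     - D (G a.+1) n k + corr n k| <=
  K * `|D b n k| ^+ 3 + e / 2 / (N + 1) * (D A n k + 2 ^- n).
  move=> kn; rewrite -(dyad_step R n k); apply: Hn0.
  - exact: dyad_ge0.
  - exact: dyad_leS.
  - exact: dyad_le1.
  - by rewrite dyad_step; exact: le_exp2N.
apply: le_trans (ler_norm_sum _ _ _) _.
apply: (@le_trans _ _ (\sum_(k < p)
    (K * `|D b n k| ^+ 3 + e / 2 / (N + 1) * (D A n k + 2 ^- n)))).
  by apply: ler_sum => k _; apply: bound; apply: leq_trans pn.
rewrite big_split /= -!mulr_sumr [leRHS]splitr; apply: lerD.
  apply: (@le_trans _ _ (K * (e / 2 / (K + 1)))).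
    rewrite ler_wpM2l//; apply: le_trans (Hn1 n n1n).
    apply: le_trans (ler_norm _).
    by apply: (@sum_widen_le _ (fun k => `|D b n k| ^+ 3)) => // k; rewrite exprn_ge0.
  have K1 : 0 < K + 1 by lra.
  by rewrite mulrA ler_pdivrMr// mulrC ler_wpM2l//; lra.
have N1 : 0 < N + 1 by lra.
have : \sum_(k < p) (D A n k + 2 ^- n) <= N + 1.
  rewrite big_split /= (dyad_telescope A) A0 subr0; apply: lerD.
    apply: le_trans (ler_norm _) (AN _ _); rewrite dyad_ge0 dyad_le1//.
  rewrite sumr_const card_ord -[leLHS]mulr_natl ler_pdivrMr ?exprn_gt0//.
  by rewrite mul1r -natrX ler_nat.
move=> h; apply: (@le_trans _ _ (e / 2 / (N + 1) * (N + 1))).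
  by apply: ler_wpM2l => //; exact: ltW.
by rewrite divfK// gt_eqF.
Unshelve. all: by end_near. Qed.

End RiemannSums.

(** * Pathwise form and size of the iterated integrals *)

Section TowersExist.
Context (R : realType).
Implicit Types (b A f g : R -> R) (G : nat -> R -> R).
Local Notation mu := (@lebesgue_measure R).

(** Brownian scaling: when [sigma] bounds the path, its square is the size of
    both time and the bracket, and iterated integrals have the order of their
    weight. *)
Definition parabolic_order b A (w : nat) f := exists2 K : R, 0 <= K &
  forall sigma t : R, 0 <= t <= 1 -> 0 <= sigma -> t <= sigma ^+ 2 ->
  (forall s, 0 <= s <= t -> `|b s| <= sigma /\ `|A s| <= sigma ^+ 2) ->
  `|f t| <= K * sigma ^+ w.

Definition hermite_tower b A a (t : R) := hermite a (A t) (b t).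

Lemma hermite_tower_order b A a : parabolic_order b A a (hermite_tower b A a).
Proof.
exists a.+1%:R => // sigma t /andP[t0 t1] s0 ts bA.
by have [bs As] := bA t ltac:(by rewrite t0 lexx); exact: hermite_le.
Qed.

Lemma hermite_tower_expand b A a s u : hermite_tower b A a u =
  \sum_(j < a.+1) hermite j (A u - A s) (b u - b s) *
    hermite_tower b A (a - j)%N s.
Proof.
have := hermiteD a (A u - A s) (A s) (b u - b s) (b s).
by rewrite !subrK.
Qed.

Lemma hermite_towerP b A : ucont b -> ucont A -> b 0 = 0 -> A 0 = 0 ->
  tower b A (hermite_tower b A).
Proof.
move=> cb cA b0 A0; split.
- by move=> a; exact: ucont_hermite.
- move=> a; exists 0 => // s u _ _ _.
  by rewrite -hermite_tower_expand subrr normr0 mul0r.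
- move=> a e e0; exists 0%N => s u _ su _ _.
  by rewrite -hermite_tower_expand subrr normr0 mulr_ge0 ?subr_ge0// ltW.
- by move=> a; rewrite /hermite_tower b0 A0 hermite00.
Qed.

Section IntegralTower.
Variables (b A g : R -> R).
Hypotheses (cb : ucont b) (cA : ucont A) (cg : ucont g).

Let phi j r := g r * hermite j (- A r) (- b r).
Let mom j t := \int[mu]_(r in `[0, t]) phi j r.

(** By the addition theorem this is
    [\int_0^t g r * hermite a (A t - A r) (b t - b r) dr]; in the expanded form
    the dependence on [t] under the integral sign disappears. *)
Definition integral_tower a t :=
  \sum_(i < a.+1) hermite (a - i) (A t) (b t) *
    \int[mu]_(r in `[0, t]) (g r * hermite i (- A r) (- b r)).

Let cphi j : ucont (phi j).
Proof. by apply: ucontM => //; apply: ucont_hermite; exact: ucontN. Qed.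

Let phi_bound : exists N : nat -> R, forall j, 0 <= N j /\
  forall t, 0 <= t <= 1 -> `|phi j t| <= N j.
Proof.
have /choice[N HN] : forall j, exists N : R, 0 <= N /\
    forall t, 0 <= t <= 1 -> `|phi j t| <= N.
  by move=> j; have [[N N0 HN] _] := cphi j; exists N; split => //; exact: ltW.
by exists N.
Qed.

Let her_bound : exists N : nat -> R, forall j, 0 <= N j /\
  forall t, 0 <= t <= 1 -> `|hermite j (A t) (b t)| <= N j.
Proof.
have /choice[N HN] : forall j, exists N : R, 0 <= N /\
    forall t, 0 <= t <= 1 -> `|hermite j (A t) (b t)| <= N.
  move=> j; have [[N N0 HN] _] := ucont_hermite j cA cb.
  by exists N; split => //; exact: ltW.
by exists N.
Qed.

Let mom_lip j : exists2 N : R, 0 <= N & forall s u, 0 <= s -> s <= u -> u <= 1 ->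
  `|mom j u - mom j s| <= N * (u - s).
Proof.
have [N HN] := phi_bound; have [N0 Nj] := HN j.
exists (N j) => // s u s0 su u1.
have := Rintegral_increment (cphi j) s0 su u1 (c := 0) (e := N j).
rewrite mul0r subr0; apply=> r ru; rewrite subr0; apply: Nj; lra.
Qed.

Let cmom j : ucont (mom j).
Proof. by have [N N0 HN] := mom_lip j; exact: lipschitz_ucont HN. Qed.

Let expandE a s u :
  \sum_(j < a.+1) hermite j (A u - A s) (b u - b s) *
    integral_tower (a - j)%N s =
  \sum_(i < a.+1) hermite (a - i) (A u) (b u) * mom i s.
Proof.
have LE (j : 'I_a.+1) : hermite j (A u - A s) (b u - b s) *
    integral_tower (a - j)%N s = \sum_(i < a.+1 | (i < (a - j).+1)%N)
    hermite j (A u - A s) (b u - b s) * hermite (a - j - i) (A s) (b s) * mom i s.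
  rewrite -(big_ord_widen _ (fun i => hermite j (A u - A s) (b u - b s) *
    hermite (a - j - i) (A s) (b s) * mom i s)) ?ltnS ?leq_subr//.
  by rewrite /integral_tower mulr_sumr; apply: eq_bigr => i _; rewrite mulrA.
rewrite (eq_bigr _ (fun j _ => LE j)).
have RE (i : 'I_a.+1) : hermite (a - i) (A u) (b u) * mom i s =
    \sum_(j < a.+1 | (j < (a - i).+1)%N)
    hermite j (A u - A s) (b u - b s) * hermite (a - i - j) (A s) (b s) * mom i s.
  rewrite -(big_ord_widen _ (fun j => hermite j (A u - A s) (b u - b s) *
    hermite (a - i - j) (A s) (b s) * mom i s)) ?ltnS ?leq_subr//.
  by rewrite -mulr_suml -hermiteD !subrK.
rewrite [RHS](eq_bigr _ (fun j _ => RE j)) (exchange_big_dep xpredT)//=.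
apply: eq_bigr => i _; apply: eq_big => [j|j _]; last by rewrite subnAC.
by have := ltn_ord i; have := ltn_ord j; lia.
Qed.

Let incrementE a s u : integral_tower a u -
  \sum_(j < a.+1) hermite j (A u - A s) (b u - b s) * integral_tower (a - j)%N s
  = \sum_(i < a.+1) hermite (a - i) (A u) (b u) * (mom i u - mom i s).
Proof.
by rewrite expandE -sumrB; apply: eq_bigr => i _; rewrite mulrBr.
Qed.

(* Above the bottom level the integrand vanishes at the upper end of the
   integral, since [hermite a.+1 0 0 = 0]. *)
Let cancel a u :
  \sum_(i < a.+2) hermite (a.+1 - i) (A u) (b u) * phi i u = 0.
Proof.
have := hermiteD a.+1 (- A u) (A u) (- b u) (b u).
rewrite !addNr hermite00 => /(congr1 (fun x => g u * x)).
rewrite mulr0 mulr_sumr => E; apply: (etrans _ (esym E)).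
by apply: eq_bigr => i _; rewrite /phi; ring.
Qed.

Lemma integral_towerP : tower b A integral_tower.
Proof.
have [H HH] := her_bound.
split.
- move=> a; apply: (@ucont_sum _ _ (fun (i : 'I_a.+1) t =>
    hermite (a - i) (A t) (b t) * mom i t)) => i.
  by apply: ucontM; [exact: ucont_hermite|exact: cmom].
- move=> a; have /choice[N HN] : forall j, exists N : R, 0 <= N /\
      forall s u, 0 <= s -> s <= u -> u <= 1 ->
      `|mom j u - mom j s| <= N * (u - s).
    by move=> j; have [N N0 HN] := mom_lip j; exists N.
  exists (\sum_(i < a.+1) H (a - i)%N * N i).
    by apply: sumr_ge0 => i _; rewrite mulr_ge0 ?(HH _).1 ?(HN _).1.
  move=> s u s0 su u1; rewrite incrementE mulr_suml.
  apply: le_trans (ler_norm_sum _ _ _) _; apply: ler_sum => i _.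
  rewrite normrM -mulrA; apply: ler_pM => //; last exact: (HN _).2.
  by apply: (HH _).2; rewrite u1 (le_trans s0).
- move=> a e e0.
  set S := \sum_(i < a.+2) H (a.+1 - i)%N.
  have S0 : 0 <= S by apply: sumr_ge0 => i _; exact: (HH _).1.
  have e1 : 0 < e / (S + 1) by rewrite divr_gt0// ltr_wpDl.
  have /choice[n Hn] j := (cphi j).2 _ e1.
  exists (\max_(i < a.+2) n i) => s u s0 su u1 us.
  have -> : integral_tower a.+1 u - \sum_(j < a.+2)
      hermite j (A u - A s) (b u - b s) * integral_tower (a.+1 - j)%N s =
    \sum_(i < a.+2) hermite (a.+1 - i) (A u) (b u) *
      (mom i u - mom i s - phi i u * (u - s)).
    rewrite incrementE; transitivity (
      \sum_(i < a.+2) hermite (a.+1 - i) (A u) (b u) * (mom i u - mom i s) -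
      (\sum_(i < a.+2) hermite (a.+1 - i) (A u) (b u) * phi i u) * (u - s)).
      by rewrite cancel mul0r subr0.
    by rewrite mulr_suml -sumrB; apply: eq_bigr => i _; ring.
  apply: (@le_trans _ _ (S * (e / (S + 1) * (u - s)))).
    rewrite mulr_suml; apply: le_trans (ler_norm_sum _ _ _) _.
    apply: ler_sum => i _; rewrite normrM; apply: ler_pM => //.
      by apply: (HH _).2; rewrite u1 (le_trans s0).
    apply: Rintegral_increment => // r /andP[sr ru]; rewrite distrC.
    apply: Hn => //; first exact: le_trans sr.
    have : u - r <= u - s by lra.
    move=> /le_trans; apply; apply: le_trans us _; apply: le_exp2N.
    exact: (@leq_bigmax _ (fun i : 'I_a.+2 => n i) i).
  rewrite mulrA ler_wpM2r ?subr_ge0//.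
  have S1 : 0 < S + 1 by lra.
  by rewrite mulrA ler_pdivrMr// mulrC ler_wpM2l ?(ltW e0)//; lra.
- move=> a; rewrite /integral_tower big1// => i _.
  by rewrite Rintegral_at0 mulr0.
Qed.

Lemma integral_tower_order w a : parabolic_order b A w g ->
  parabolic_order b A (w + 2 + a) (integral_tower a).
Proof.
move=> [K K0 HK].
exists (\sum_(i < a.+1) (a - i).+1%:R * (K * i.+1%:R)).
  by apply: sumr_ge0 => i _; rewrite !mulr_ge0.
move=> sigma t t01 s0 ts bA; have /andP[t0 t1] := t01.
rewrite mulr_suml; apply: le_trans (ler_norm_sum _ _ _) _.
apply: ler_sum => i _; have ia : (i <= a)%N by rewrite -ltnS.
have -> : (a - i).+1%:R * (K * i.+1%:R) * sigma ^+ (w + 2 + a) =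
  ((a - i).+1%:R * sigma ^+ (a - i)) *
    (K * sigma ^+ w * (i.+1%:R * sigma ^+ i) * sigma ^+ 2).
  have -> : (w + 2 + a = (a - i) + w + i + 2)%N by lia.
  by rewrite !exprD; ring.
have [bt At] := bA t ltac:(by rewrite t0 lexx).
rewrite normrM; apply: ler_pM => //; first exact: hermite_le.
apply: (@le_trans _ _ (K * sigma ^+ w * (i.+1%:R * sigma ^+ i) * t)).
  apply: (Rintegral_bound (cphi i) t01) => r /andP[r0 rt]; rewrite normrM.
  have [br Ar] := bA r ltac:(by rewrite r0 rt).
  apply: ler_pM => //; last by apply: hermite_le; rewrite normrN.
  apply: HK => //; [lra|lra|].
  by move=> s /andP[s'0 sr]; apply: bA; lra.
by apply: ler_wpM2l => //; rewrite !mulr_ge0 ?exprn_ge0.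
Qed.

End IntegralTower.

Definition parabolic_weight (I : seq 'I_2) : nat :=
  sumn [seq (if i == ord0 then 2 else 1)%N | i <- I].

(** Reading a word from the left, a letter [dB] climbs one step in the current
    tower, and a letter [dt] starts a new tower at its bottom level. *)
Lemma word_tower sense b A nl (X : seq 'I_2 -> R -> R) :
  driving_path sense b A nl ->
  (forall I, ucont (X I)) ->
  (forall t, 0 <= t <= 1 -> X [::] t = 1) ->
  (forall I t, 0 <= t <= 1 -> X (rcons I ord0) t =
    \int[mu]_(s in `[0, t]) X I s) ->
  (forall I m i, (i <= 2 ^ m)%N ->
    (fun l => dyadic_riemann_sum sense (X I) b (nl l) (i * 2 ^ (nl l - m)))
      @ \oo --> X (rcons I ord_max) (dyad R m i)) ->
  forall I, exists G a w, [/\ tower b A G,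
    forall t, 0 <= t <= 1 -> X I t = G a t,
    parabolic_weight I = (w + a)%N &
    forall a', parabolic_order b A (w + a') (G a')].
Proof.
move=> dp cX X0 Xdt XdB; have [cb cA b0 A0 _ nlP _ _] := dp.
elim/last_ind => [|I i [G [a [w [tG XG Iwa oG]]]]].
  exists (hermite_tower b A), 0%N, 0%N; split => //.
  - exact: hermite_towerP.
  - by move=> t t01; rewrite X0// /hermite_tower hermite0.
  - by move=> a'; exact: hermite_tower_order.
rewrite /parabolic_weight map_rcons sumn_rcons -/(parabolic_weight I) Iwa.
have oX : parabolic_order b A (w + a) (X I).
  have [K K0 HK] := oG a; exists K => // sigma t t01 *.
  by rewrite XG// HK.
have /orP[/eqP i0|/eqP i1] : (i == ord0) || (i == ord_max).
  by case: i => -[|[|[]]].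
- exists (integral_tower b A (X I)), 0%N, (w + a + 2)%N; split => //.
  + exact: integral_towerP.
  + move=> t t01; rewrite i0 Xdt// /integral_tower big_ord_recl big_ord0 addr0.
    by rewrite hermite0 mul1r; under [RHS]eq_Rintegral do rewrite hermite0 mulr1.
  + by rewrite i0 eqxx addn0.
  + by move=> a'; exact: integral_tower_order.
- exists G, a.+1, w; split => //.
  + move=> t t01; rewrite i1; apply: ucont_eq_dyadic t01 => //.
      exact: tower_ucont tG _.
    move=> m k km; have := XdB I m k km.
    have := tower_riemann_sum dp tG (a := a) km => h1 h2.
    have E : \forall l \near \oo,
        dyadic_riemann_sum sense (X I) b (nl l) (k * 2 ^ (nl l - m)) =
        dyadic_riemann_sum sense (G a) b (nl l) (k * 2 ^ (nl l - m)).
      near=> l; have ml : (m <= nl l)%N.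
        by apply: leq_trans (nlP l); near: l; exact: nbhs_infty_ge.
      apply: eq_bigr => j _; congr (_ * _).
      have jl : (j < 2 ^ nl l)%N.
        by apply: leq_trans (refine_le ml km); exact: ltn_ord.
      have jk : 0 <= dyad R (nl l) j <= 1 by rewrite dyad_ge0 dyad_le1// ltnW.
      have jk1 : 0 <= dyad R (nl l) j.+1 <= 1 by rewrite dyad_ge0 dyad_le1.
      by case: sense {dp XdB h1 h2} => /=; rewrite !XG.
    have h2' := cvg_trans (near_eq_cvg E) h2.
    by rewrite -(cvg_lim (@Rhausdorff R) (h2' _)) (cvg_lim (@Rhausdorff R) h1).
  + by rewrite i1 /=; lia.
Unshelve. all: by end_near. Qed.

Lemma word_order sense b A nl (X : seq 'I_2 -> R -> R) :
  driving_path sense b A nl ->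
  (forall I, ucont (X I)) ->
  (forall t, 0 <= t <= 1 -> X [::] t = 1) ->
  (forall I t, 0 <= t <= 1 -> X (rcons I ord0) t =
    \int[mu]_(s in `[0, t]) X I s) ->
  (forall I m i, (i <= 2 ^ m)%N ->
    (fun l => dyadic_riemann_sum sense (X I) b (nl l) (i * 2 ^ (nl l - m)))
      @ \oo --> X (rcons I ord_max) (dyad R m i)) ->
  forall I, parabolic_order b A (parabolic_weight I) (X I).
Proof.
move=> dp cX X0 Xdt XdB I.
have [G [a [w [_ XG -> oG]]]] := word_tower dp cX X0 Xdt XdB I.
have [K K0 HK] := oG a; exists K => // sigma t t01 *.
by rewrite XG// HK.
Qed.

End TowersExist.

(** * Coefficients, displacement of the flow and the Taylor error *)

Section ComplexPowers.
Context (K : numFieldType).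

Lemma lower_degree_by_two (k c n z p : K) : z != 0 -> p != 0 ->
  k / z * (c * n / p) = k * (c * n) * (z * (p^-1 * (z^-1 / z))).
Proof. by move=> z0 p0; field; rewrite ?z0 ?p0. Qed.

Lemma lower_degree_by_one (c n z p : K) : z != 0 -> p != 0 ->
  c * n / p = c * n * (z * (z^-1 / p)).
Proof. by move=> z0 p0; field; rewrite ?z0 ?p0. Qed.

Lemma derive1_shifted_power (f : K -> K^o) (c z : K) (w : nat) : z != 0 ->
  (forall x, x != 0 -> f x = c * (x * x^-1 ^+ w)) ->
  derive1 f z = c * (1 - w%:R) * z^-1 ^+ w.
Proof.
move=> z0 fE; rewrite derive1E.
pose g : K -> K^o := (fun=> c) * (id * ((fun x : K => x^-1 : K^o) ^+ w)).
rewrite (@near_eq_derive _ K K^o f g); last first.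
  near=> x; rewrite fE /g; last by near: x; apply: (cvgr_neq0 z).
  by rewrite !fctE.
have dV : is_derive z 1 (fun x : K => x^-1 : K^o) (- z ^- 2 *: 1).
  by constructor; [exact: derivableV|rewrite deriveV// derive_id].
rewrite /g derive_val !fctE scaler0 addr0 /GRing.scale/= !mulr1.
case: w {fE g} => [|w]; first by rewrite expr0; ring.
by rewrite /= !exprS !exprVn; field; rewrite z0 expf_neq0.
Unshelve. all: by end_near. Qed.

End ComplexPowers.

Section TaylorCoefficients.
Context (R : realType).
Local Notation C := (R[i] : numFieldType).

(** Away from the pole the coefficient functions are monomials, by parabolic
    scaling: [V_1] lowers the degree by one and [V_0] by two. *)
Lemma iterated_vector_field_monomial (kappa : R) (I : seq 'I_2) :
  exists c : C, forall z : C, z != 0 ->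
  iterated_vector_field kappa I z = c * (z * z^-1 ^+ parabolic_weight I).
Proof.
elim: I => [|i I [c IH]]; first by exists 1 => z _; rewrite mul1r mulr1.
have D z : z != 0 -> _ := fun z0 => derive1_shifted_power z0 IH.
rewrite /parabolic_weight /= -/(parabolic_weight I).
set w := parabolic_weight I in IH D *.
have [i0|i0] := boolP (i == ord0).
  exists ((- 2 / kappa)%:C * (c * (1 - w%:R))) => z z0.
  rewrite /= /vector_field i0 D// /loewner_drift addnC exprD expr2.
  by rewrite !exprVn; exact: (@lower_degree_by_two C _ c _ z (z ^+ w) z0 (expf_neq0 w z0)).
exists (c * (1 - w%:R)) => z z0.
rewrite /= /vector_field (negbTE i0) D// exprS.
by rewrite !exprVn; exact: (@lower_degree_by_one C c _ z (z ^+ w) z0 (expf_neq0 w z0)).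
Qed.

End TaylorCoefficients.

Section LoewnerDisplacement.
Context (R : realType).

Lemma normc_le_ReIm (z : R[i]) :
  `|z| <= (`|complex.Re z| + `|complex.Im z|)%:C.
Proof.
rewrite normc_def lecR.
set x := complex.Re z; set y := complex.Im z.
have s0 : 0 <= `|x| + `|y| by rewrite addr_ge0.
rewrite -[leRHS](ger0_norm s0) -sqrtr_sqr ler_sqrt ?sqr_ge0//.
rewrite sqrrD !real_normK ?num_real// lerD2r lerDl.
by rewrite mulrn_wge0// mulr_ge0.
Qed.

Lemma loewner_driftE (kappa : R) (z : R[i]) :
  let n := complex.Re z ^+ 2 + complex.Im z ^+ 2 in
  loewner_drift kappa z =
  (- 2 / kappa * (complex.Re z / n)) +i* (2 / kappa * (complex.Im z / n)).
Proof.
case: z => x y /=; rewrite /loewner_drift.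
set n := x ^+ 2 + y ^+ 2.
have -> : (x +i* y)^-1 = (x / n) -i* (y / n) :> R[i] by [].
by simpc; congr (_ +i* _); ring.
Qed.

(** The imaginary part only grows, so the drift stays of order [1 / eps]. *)
Lemma loewner_displacement (kappa eps : R) (b : R -> R) (Z : R -> R[i]) t :
  0 < kappa -> 0 < eps -> 0 <= t <= 1 -> solves_loewner kappa (eps *i) b Z ->
  `|Z t - eps *i| <= (4 / kappa * (t / eps) + `|b t|)%:C.
Proof.
move=> k0 e0 t01 [cRe cIm HZ Zeq].
pose n s := complex.Re (Z s) ^+ 2 + complex.Im (Z s) ^+ 2.
have Im_ge s : 0 <= s -> eps <= complex.Im (Z s).
  move=> s0; rewrite (Zeq _ s0) /= addr0 lerDl; apply: Rintegral_ge0 => r /=.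
  rewrite in_itv/= => /andP[r0 _]; rewrite loewner_driftE /=.
  have Ir : 0 < complex.Im (Z r) := HZ _ r0.
  by rewrite !mulr_ge0 ?invr_ge0 ?addr_ge0 ?sqr_ge0 ?ltW.
have n_ge s : 0 <= s -> eps ^+ 2 <= n s.
  move=> /Im_ge es; apply: (@le_trans _ _ (complex.Im (Z s) ^+ 2)).
    by apply: lerXn2r => //; rewrite ?nnegrE ?(ltW e0) ?(le_trans (ltW e0)).
  by rewrite lerDr sqr_ge0.
have e20 : 0 < eps ^+ 2 by rewrite exprn_gt0.
have cR := within_ucont cRe; have cI := within_ucont cIm.
have cn : ucont (fun s => (n s)^-1).
  apply: (ucontV e20); first by move=> s /andP[s0 _]; exact: n_ge.
  by apply: ucontD; exact: ucontX.
have k20 : 0 <= 2 / kappa by rewrite divr_ge0// ltW.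
have bound s x : 0 <= s -> `|x| * eps <= n s -> `|x / n s| <= eps^-1.
  move=> s0 xn; have ns0 : 0 < n s by exact: lt_le_trans (n_ge _ s0).
  by rewrite normrM normfV (gtr0_norm ns0) ler_pdivrMr// ler_pdivlMl// mulrC.
have bR : `|\int[lebesgue_measure]_(s in `[0, t])
    complex.Re (loewner_drift kappa (Z s))| <= 2 / kappa * eps^-1 * t.
  apply: Rintegral_bound => //.
    under eq_fun do rewrite loewner_driftE /=.
    exact: ucontM (ucont_cst _) (ucontM cR cn).
  move=> r /andP[r0 _]; rewrite loewner_driftE /= mulNr mulNr normrN normrM.
  rewrite (ger0_norm k20) ler_wpM2l//; apply: bound => //.
  have := n_ge _ r0; have := Im_ge _ r0; rewrite /n.
  set x := complex.Re _; set y := complex.Im _ => ey _.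
  have := sqr_ge0 (`|x| - eps); rewrite sqrrB real_normK ?num_real//.
  have : eps ^+ 2 <= y ^+ 2 by apply: lerXn2r => //; rewrite ?nnegrE ?(ltW e0) ?(le_trans (ltW e0)).
  have : 0 <= x ^+ 2 by rewrite sqr_ge0.
  have : 0 <= y ^+ 2 by rewrite sqr_ge0.
  rewrite mulr2n; have : 0 <= `|x| * eps by rewrite mulr_ge0// ltW.
  lra.
have bI : `|\int[lebesgue_measure]_(s in `[0, t])
    complex.Im (loewner_drift kappa (Z s))| <= 2 / kappa * eps^-1 * t.
  apply: Rintegral_bound => //.
    under eq_fun do rewrite loewner_driftE /=.
    exact: ucontM (ucont_cst _) (ucontM cI cn).
  move=> r /andP[r0 _]; rewrite loewner_driftE /= normrM.
  rewrite (ger0_norm k20) ler_wpM2l//; apply: bound => //.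
  have ey := Im_ge _ r0.
  have y0 : 0 <= complex.Im (Z r) by apply: le_trans ey; exact: ltW.
  rewrite ger0_norm// (@le_trans _ _ (complex.Im (Z r) ^+ 2))//.
    by rewrite expr2 ler_wpM2l.
  by rewrite lerDr sqr_ge0.
have /andP[t0 _] := t01.
rewrite (Zeq _ t0); set J1 := Rintegral _ _ _ in bR *; set J2 := Rintegral _ _ _ in bI *.
apply: le_trans (normc_le_ReIm _) _; rewrite lecR /=.
have -> : 0 + J1 + b t - 0 = J1 + b t by ring.
have -> : eps + J2 + 0 - eps = J2 by ring.
have := ler_normD J1 (b t).
have -> : 4 / kappa * (t / eps) = 2 / kappa * eps^-1 * t + 2 / kappa * eps^-1 * t.
  by ring.
lra.
Qed.

End LoewnerDisplacement.

Section TaylorError.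
Context (R : realType).

Lemma real_complex_le (x y : R) : x <= y -> x%:C <= y%:C.
Proof. by rewrite lecR. Qed.

Lemma normc_imaginary (eps : R) : 0 <= eps -> `|eps *i| = eps%:C.
Proof.
by move=> e0; rewrite normc_def /= expr0n add0r sqrtr_sqr ger0_norm.
Qed.

Lemma normc_real (x : R) : `|x%:C| = `|x|%:C.
Proof. by rewrite normc_def /= expr0n addr0 sqrtr_sqr. Qed.

Lemma parabolic_weight_gt0 (I : seq 'I_2) : (0 < size I)%N ->
  (0 < parabolic_weight I)%N.
Proof. by case: I => //= i I _; rewrite /parabolic_weight /=; case: ifP; lia. Qed.

Lemma taylor_term_le kappa (b A : R -> R) (x : R -> R) (I : seq 'I_2) :
  (0 < size I)%N -> parabolic_order b A (parabolic_weight I) x ->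
  exists2 K : R, 0 <= K & forall eps sigma t : R,
  0 < eps -> 0 <= sigma -> sigma <= eps -> 0 <= t <= 1 -> t <= sigma ^+ 2 ->
  (forall s, 0 <= s <= t -> `|b s| <= sigma /\ `|A s| <= sigma ^+ 2) ->
  `|(iterated_vector_field kappa I (eps *i) : R[i]) * (x t)%:C|
    <= (K * sigma)%:C.
Proof.
move=> /parabolic_weight_gt0; set w := parabolic_weight I => w0 [K K0 HK].
have [c cE] := iterated_vector_field_monomial kappa I.
pose g := Num.sqrt (complex.Re c ^+ 2 + complex.Im c ^+ 2).
have g0 : 0 <= g by exact: sqrtr_ge0.
have cg : `|c| = g%:C by rewrite normc_def.
exists (g * K); first exact: mulr_ge0.
move=> eps sigma t e0 s0 se t01 ts bA.
have ei0 : eps *i != 0 by rewrite eq_complex /= negb_and (gt_eqF e0) orbT.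
rewrite (cE _ ei0) -/w !normrM normrX normfV (normc_imaginary (ltW e0)) cg normc_real.
have -> : g%:C * (eps%:C * eps%:C^-1 ^+ w) * `|x t|%:C =
    (g * (eps * eps^-1 ^+ w) * `|x t|)%:C.
  by rewrite !rmorphM rmorphXn fmorphV.
apply: real_complex_le.
have h := HK sigma t t01 s0 ts bA.
have q1 : sigma / eps <= 1 by rewrite ler_pdivrMr// mul1r.
have q0 : 0 <= sigma / eps by rewrite divr_ge0// ltW.
rewrite -!mulrA ler_wpM2l//.
apply: (@le_trans _ _ (eps * (eps^-1 ^+ w * (K * sigma ^+ w)))).
  by rewrite !ler_wpM2l ?exprn_ge0 ?invr_ge0 ?(ltW e0).
have -> : eps * (eps^-1 ^+ w * (K * sigma ^+ w)) =
    K * (sigma * (sigma / eps) ^+ w.-1).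
  rewrite -(prednK w0) /= !exprS exprMn.
  by field; rewrite gt_eqF.
by rewrite ler_wpM2l// ler_piMr// exprn_ile1.
Qed.

(** The coefficient of a word of weight [w] is of order [eps ^ (1 - w)] and its
    iterated integral of order [sigma ^ w]. When the size [sigma] of the noise
    is below [eps], every term but the constant one is thus of order [sigma],
    and so is the displacement of the flow. *)
Lemma taylor_error kappa r (b A : R -> R) (X : seq 'I_2 -> R -> R) : 0 < kappa ->
  (forall I, parabolic_order b A (parabolic_weight I) (X I)) ->
  (forall t, 0 <= t <= 1 -> X [::] t = 1) ->
  exists2 K : R, 0 <= K & forall (eps sigma t : R) (Z : R -> R[i]),
  0 < eps -> 0 <= sigma -> sigma <= eps -> 0 <= t <= 1 -> t <= sigma ^+ 2 ->
  (forall s, 0 <= s <= t -> `|b s| <= sigma /\ `|A s| <= sigma ^+ 2) ->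
  solves_loewner kappa (eps *i) b Z ->
  `|Z t - taylor_approximation kappa r (eps *i) (fun I => X I t)|
    <= (K * sigma)%:C.
Proof.
move=> k0 oX X0.
have /choice[K HK] : forall I : seq 'I_2, exists K : R, 0 <= K /\
  ((0 < size I)%N -> forall eps sigma t : R,
  0 < eps -> 0 <= sigma -> sigma <= eps -> 0 <= t <= 1 -> t <= sigma ^+ 2 ->
  (forall s, 0 <= s <= t -> `|b s| <= sigma /\ `|A s| <= sigma ^+ 2) ->
  `|(iterated_vector_field kappa I (eps *i) : R[i]) * (X I t)%:C|
    <= (K * sigma)%:C).
  move=> I; have [I0|I0] := ltnP 0%N (size I); last by exists 0; split.
  by have [K K0 HK] := taylor_term_le kappa I0 (oX I); exists K; split.
set S := \sum_(k < r) \sum_(I : k.+1.-tuple 'I_2) K I.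
have S0 : 0 <= S by rewrite !sumr_ge0// => i _; rewrite sumr_ge0// => I _; exact: (HK _).1.
have k40 : 0 <= 4 / kappa by rewrite divr_ge0// ltW.
exists (4 / kappa + 1 + S); first by rewrite !addr_ge0.
move=> eps sigma t Z e0 s0 se t01 ts bA solZ.
rewrite /taylor_approximation big_ord_recl /=.
rewrite (big_pred1 [tuple]) => [|I]; last by rewrite [I]tuple0; apply/esym/eqP.
rewrite /= X0// mulr1 opprD addrA; apply: le_trans (ler_normB _ _) _.
rewrite mulrDl rmorphD lerD//=.
  apply: le_trans (loewner_displacement k0 e0 t01 solZ) _; apply: real_complex_le.
  rewrite [leRHS]mulrDl mul1r; apply: lerD.
    rewrite ler_wpM2l// ler_pdivrMr//; apply: le_trans ts _.
    by rewrite expr2 ler_wpM2l.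
  by have [] := bA t ltac:(by move: t01; rewrite lexx => /andP[-> _]).
apply: le_trans (ler_norm_sum _ _ _) _; rewrite mulr_suml rmorph_sum /=.
apply: ler_sum => k _.
apply: le_trans (ler_norm_sum _ _ _) _; rewrite mulr_suml rmorph_sum /=.
apply: ler_sum => I _; apply: (HK _).2 => //.
by rewrite size_tuple.
Qed.

End TaylorError.

(** * Gaussian increments *)

Section SummableEvents.
Context (R : realType) (d : measure_display) (T : measurableType d).
Variable P : probability T R.

Lemma measurable_superlevel d' (U : measurableType d') (f : U -> R) a :
  measurable_fun setT f -> measurable [set x | a <= f x].
Proof.
move=> mf; have := mf measurableT _ (measurable_itv `[a, +oo[).
rewrite setTI; congr measurable; apply/seteqP; split=> x /=;
  by rewrite in_itv/= andbT.
Qed.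

Lemma geometric_partial_sum_le (rho : R) n : 0 <= rho -> rho < 1 ->
  \sum_(k < n) rho ^+ k <= (1 - rho)^-1.
Proof.
move=> r0 r1; have r10 : 0 < 1 - rho by rewrite subr_gt0.
rewrite -[leRHS]mul1r ler_pdivlMr// mulrC.
have -> : (1 - rho) * \sum_(k < n) rho ^+ k = 1 - rho ^+ n.
  by rewrite -[1 - rho]opprB mulNr -subrX1 opprB.
by rewrite lerBlDr lerDl exprn_ge0.
Qed.

Lemma borel_cantelli_geometric (F : nat -> set T) (M rho : R) :
  0 <= M -> 0 <= rho -> rho < 1 -> (forall n, measurable (F n)) ->
  (forall n, (P (F n) <= (M * rho ^+ n)%:E)%E) ->
  {ae P, forall w, exists n0, forall n, (n0 <= n)%N -> ~ F n w}.
Proof.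
move=> M0 r0 r1 mF PF.
have r10 : 0 < 1 - rho by rewrite subr_gt0.
have sum_lty : (\sum_(n <oo) P (F n) < +oo)%E.
  apply: (@le_lt_trans _ _ (M / (1 - rho))%:E); last exact: ltry.
  apply: lime_le; first by apply: is_cvg_nneseries.
  apply: nearW => n; rewrite big_mkord.
  apply: (@le_trans _ _ (\sum_(k < n) (M * rho ^+ k)%:E)%E).
    by apply: lee_sum => k _; exact: PF.
  rewrite sumEFin lee_fin -mulr_sumr ler_wpM2l//.
  exact: geometric_partial_sum_le.
exists (lim_sup_set F); split.
- by apply: bigcap_measurable => // n _; apply: bigcup_measurable => k _; exact: mF.
- exact: lim_sup_set_cvg0.
- move=> w /= /forallNP Nw n _; have /existsNP[k] := Nw n.
  by move=> /not_implyP[nk /contrapT Fk]; exists k.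
Qed.

End SummableEvents.

Section GaussianTails.
Context (R : realType).
Local Notation mu := (@lebesgue_measure R).

Definition gaussian_tail_constant (p : nat) : R := 2 * p`!%:R * 4 ^+ p.

(** Half of the Gaussian exponent beats any power of [y / s]; the other half
    is the density of a Gaussian of twice the variance. *)
Lemma normal_pdf_tail_le (p : nat) (s x y : R) : 0 < s -> 0 < x -> x <= `|y| ->
  normal_pdf 0 s y <= gaussian_tail_constant p.+1 * (s ^+ 2 / x ^+ 2) ^+ p.+1 *
    normal_pdf 0 (Num.sqrt 2 * s) y.
Proof.
move=> s0 x0 xy.
have r20 : 0 < Num.sqrt (2 : R) by rewrite sqrtr_gt0.
have rs0 : 0 < Num.sqrt 2 * s by rewrite mulr_gt0.
rewrite !normal_pdfE ?gt_eqF//.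
pose u := y ^+ 2 / (4 * s ^+ 2).
have s20 : 0 < s ^+ 2 by rewrite exprn_gt0.
have x20 : 0 < x ^+ 2 by rewrite exprn_gt0.
have u0 : 0 <= u by rewrite divr_ge0 ?sqr_ge0// mulr_ge0// ltW.
have fE : normal_fun 0 s y = expR (- u) * expR (- u).
  rewrite -expRD /normal_fun subr0 /u mulr2n; congr expR.
  by field; rewrite !gt_eqF ?addr_gt0.
have gE : normal_fun 0 (Num.sqrt 2 * s) y = expR (- u).
  rewrite /normal_fun subr0 /u mulr2n exprMn sqr_sqrtr//; congr expR.
  by field; rewrite !gt_eqF ?addr_gt0 ?mulr_gt0.
have peakE : normal_peak s = Num.sqrt 2 * normal_peak (Num.sqrt 2 * s).
  rewrite /normal_peak exprMn sqr_sqrtr//.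
  have -> : 2 * s ^+ 2 * pi *+ 2 = 2 * (s ^+ 2 * pi *+ 2) :> R by ring.
  by rewrite sqrtrM// invfM mulrA divff ?mul1r// gt_eqF.
have eu : expR (- u) <= p.+1`!%:R * 4 ^+ p.+1 * (s ^+ 2 / x ^+ 2) ^+ p.+1.
  pose v := x ^+ 2 / (4 * s ^+ 2).
  have v0 : 0 < v by rewrite divr_gt0// mulr_gt0.
  have vu : v <= u.
    rewrite ler_pM2r ?invr_gt0 ?mulr_gt0// -[y ^+ 2]real_normK ?num_real//.
    by apply: lerXn2r; rewrite ?nnegrE// ltW.
  have vp : 0 < v ^+ p.+1 by rewrite exprn_gt0.
  have fp : 0 < p.+1`!%:R :> R by rewrite ltr0n fact_gt0.
  have -> : p.+1`!%:R * 4 ^+ p.+1 * (s ^+ 2 / x ^+ 2) ^+ p.+1 =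
      (v ^+ p.+1 / p.+1`!%:R)^-1.
    rewrite invf_div -mulrA -exprMn -[in RHS]exprVn; congr (_ * _ ^+ _).
    by rewrite /v; field; rewrite !gt_eqF.
  rewrite expRN lef_pV2 ?posrE ?expR_gt0 ?divr_gt0//.
  apply: (@le_trans _ _ (expR v)); last by rewrite ler_expR.
  by apply: le_trans (expR_ge1Dxn p (ltW v0)); rewrite lerDr.
rewrite fE gE peakE.
set e := expR (- u) in eu *; set k := normal_peak _.
have e0 : 0 <= e by exact: expR_ge0.
have k0 : 0 <= k by exact: normal_peak_ge0.
rewrite /gaussian_tail_constant; set c := p.+1`!%:R * 4 ^+ p.+1 * _ in eu.
have -> : 2 * p.+1`!%:R * 4 ^+ p.+1 * (s ^+ 2 / x ^+ 2) ^+ p.+1 * (k * e) =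
  2 * (k * (c * e)) by rewrite /c; ring.
have -> : Num.sqrt 2 * k * (e * e) = Num.sqrt 2 * (k * (e * e)) by ring.
apply: ler_pM; rewrite ?(ltW r20) ?mulr_ge0//.
  rewrite -[leRHS](@ger0_norm R 2)// -sqrtr_sqr ler_sqrt; lra.
by rewrite !ler_wpM2l// ler_wpM2r.
Qed.

Lemma normal_prob_tail (p : nat) (s x : R) : 0 < s -> 0 < x ->
  (normal_prob 0 s [set y | (x <= `|y|)%R] <=
   (gaussian_tail_constant p.+1 * (s ^+ 2 / x ^+ 2) ^+ p.+1)%:E)%E.
Proof.
move=> s0 x0; rewrite /normal_prob.
have r20 : 0 < Num.sqrt (2 : R) by rewrite sqrtr_gt0.
set c := gaussian_tail_constant p.+1 * _.
have c0 : 0 <= c by rewrite !mulr_ge0// ?exprn_ge0// divr_ge0// sqr_ge0.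
have mA : measurable [set y : R | x <= `|y|].
  exact: (@measurable_superlevel _ _ (measurableTypeR R) _ x (@normr_measurable R setT)).
apply: (@le_trans _ _ (\int[mu]_(y in [set y | (x <= `|y|)%R])
    (c%:E * (normal_pdf 0 (Num.sqrt 2 * s) y)%:E)))%E.
  apply: ge0_le_integral => //.
  - by move=> y _; rewrite lee_fin normal_pdf_ge0.
  - by apply/measurable_EFinP/measurable_funTS; exact: measurable_normal_pdf.
  - apply: emeasurable_funM => //.
    by apply/measurable_EFinP/measurable_funTS; exact: measurable_normal_pdf.
  - by move=> y xy; rewrite -EFinM lee_fin; exact: normal_pdf_tail_le.
apply: (@le_trans _ _ (\int[mu]_y (c%:E * (normal_pdf 0 (Num.sqrt 2 * s) y)%:E)))%E.
  apply: ge0_subset_integral => //.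
    apply: emeasurable_funM => //.
    by apply/measurable_EFinP; exact: measurable_normal_pdf.
  by move=> y _; rewrite -EFinM lee_fin mulr_ge0// normal_pdf_ge0.
rewrite ge0_integralZl//.
- by rewrite integral_normal_pdf ?mule1// gt_eqF// mulr_gt0.
- by apply/measurable_EFinP; exact: measurable_normal_pdf.
- by move=> y _; rewrite lee_fin normal_pdf_ge0.
Qed.

End GaussianTails.

Section LayerCake.
Context (R : realType).

Lemma inverse_squares_sum_le J : \sum_(j < J) (j.+1%:R ^- 2) <= 2 :> R.
Proof.
suff : \sum_(j < J) (j.+1%:R ^- 2) <= 2 - 2 / J.+1%:R :> R.
  by move=> /le_trans; apply; rewrite lerBlDr lerDl divr_ge0.
elim: J => [|J IH]; first by rewrite big_ord0 divr1 subrr.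
rewrite big_ord_recr /=; apply: le_trans (lerD IH (lexx _)) _.
rewrite -(natr1 J.+1); set j : R := J.+1%:R.
have j1 : 1 <= j by rewrite ler1n.
have j0 : 0 < j by lra.
have j10 : 0 < j + 1 by lra.
rewrite -subr_ge0.
have -> : 2 - 2 / (j + 1) - (2 - 2 / j + j ^- 2) = (j - 1) / (j ^+ 2 * (j + 1)).
  by field; rewrite !gt_eqF.
by rewrite divr_ge0 ?mulr_ge0 ?exprn_ge0 ?subr_ge0//; lra.
Qed.

(** Discrete layer-cake formula with layers of height [h]. *)
Lemma layer_cake_le (y h : R) J : 0 <= h ->
  Num.min y (J%:R * h) <= \sum_(j < J) h * (j%:R * h <= y)%R%:R.
Proof.
move=> h0; elim: J => [|J IH]; first by rewrite big_ord0 mul0r ge_min lexx orbT.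
rewrite big_ord_recr /=; have [Jy|yJ] := leP (J%:R * h) y.
  move: IH; rewrite min_r// mulr1 => IH; rewrite ge_min; apply/orP; right.
  by rewrite -natr1 mulrDl mul1r lerD2r.
rewrite mulr0 addr0 ge_min; apply/orP; left.
by move: IH; rewrite min_l// ltW.
Qed.

End LayerCake.

Section BrownianIncrements.
Context (R : realType) (d : measure_display) (T : measurableType d).
Variables (P : probability T R) (B : R -> T -> R).
Hypothesis bm : standard_brownian_motion P B.

Let mB t : 0 <= t -> measurable_fun setT (B t).
Proof. by have [+ _ _ _ _] := bm; exact. Qed.

Lemma brownian_increment_tail (p : nat) (s t x : R) : 0 <= s -> s < t -> 0 < x ->
  (P [set w | (x <= `|B t w - B s w|)%R] <=
   (gaussian_tail_constant R p.+1 * ((t - s) / x ^+ 2) ^+ p.+1)%:E)%E.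
Proof.
move=> s0 st x0; have [_ _ _ gB _] := bm.
have ts0 : 0 < t - s by rewrite subr_gt0.
rewrite (gB s t [set y | (x <= `|y|)%R])//.
  have := normal_prob_tail p (_ : 0 < Num.sqrt (t - s)) x0.
  by rewrite sqr_sqrtr ?(ltW ts0)//; apply; rewrite sqrtr_gt0.
exact: (@measurable_superlevel _ _ (measurableTypeR R) _ x (@normr_measurable R setT)).
Qed.

(** Cut the square of the increment into layers of height [t - s]: by the tail
    bound of order four their probabilities are summable inverse squares. *)
Lemma brownian_increment_sqr : exists2 K : R, 0 <= K & forall s t : R,
  0 <= s -> s < t ->
  (\int[P]_w (((B t w - B s w) ^+ 2)%R)%:E <= (K * (t - s))%:E)%E.
Proof.
set C := gaussian_tail_constant R 2.
have C0 : 0 <= C by rewrite !mulr_ge0// exprn_ge0.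
exists (1 + 2 * C); first by rewrite addr_ge0// mulr_ge0.
move=> s t s0 st; set h := t - s.
have h0 : 0 < h by rewrite subr_gt0.
pose Y w := (B t w - B s w) ^+ 2.
have mY : measurable_fun setT Y.
  by apply: measurable_funX; apply: measurable_funB; apply: mB; rewrite // (le_trans s0)// ltW.
pose E (j : nat) := [set w | (j%:R * h <= Y w)%R].
have mE j : measurable (E j) by exact: measurable_superlevel.
have E1 j w : (j%:R * h <= Y w)%R%:R = \1_(E j) w :> R.
  rewrite indicE; have -> : (w \in E j) = (j%:R * h <= Y w)%R; last by [].
  by apply/idP/idP => [/set_mem//|H]; exact/mem_set.
have PE j : (P (E j.+1) <= (C * j.+1%:R ^- 2)%:E)%E.
  have jh : 0 < j.+1%:R * h by rewrite mulr_gt0.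
  have x0 : 0 < Num.sqrt (j.+1%:R * h) by rewrite sqrtr_gt0.
  have := brownian_increment_tail 1 s0 st x0.
  rewrite sqr_sqrtr ?(ltW jh)// -/C.
  have -> : ((t - s) / (j.+1%:R * h)) ^+ 2 = j.+1%:R ^- 2.
    rewrite -exprVn -/h; congr (_ ^+ 2).
    by rewrite invfM mulrCA divff ?mulr1// gt_eqF.
  apply: le_trans; apply: le_measure; rewrite ?inE//.
    apply: measurable_superlevel; apply: measurableT_comp => //.
    by apply: measurable_funB; apply: mB; rewrite // (le_trans s0)// ltW.
  by move=> w /=; rewrite /E /Y /= -sqrtr_sqr => H; rewrite ler_sqrt// sqr_ge0.
clearbody h.
apply: (@le_trans _ _ (\int[P]_w \sum_(j <oo) (h * \1_(E j) w)%:E)%E).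
  apply: ge0_le_integral => //.
  - by move=> w _; rewrite lee_fin sqr_ge0.
  - exact/measurable_EFinP.
  - apply: ge0_emeasurable_sum => //.
      by move=> k w _ _; rewrite lee_fin mulr_ge0// ltW.
    move=> k _; apply/measurable_EFinP; apply: measurable_funM => //.
  - move=> w _; pose J := (Num.truncn (Y w / h)).+1.
    have YJ : Y w <= J%:R * h.
      by rewrite -ler_pdivrMr// ltW// truncnS_gt.
    have := layer_cake_le (Y w) J (ltW h0).
    rewrite min_l// -lee_fin => /le_trans; apply.
    under eq_bigr do rewrite E1.
    rewrite -sumEFin -(big_mkord xpredT (fun j => (h * \1_(E j) w)%:E)).
    by apply: nneseries_lim_ge => k _ _; rewrite lee_fin mulr_ge0// ltW.
rewrite integral_nneseries//; last 2 first.
  - by move=> j; apply/measurable_EFinP; apply: measurable_funM.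
  - by move=> j w _; rewrite lee_fin mulr_ge0// ltW.
have intE j : (\int[P]_w (h * \1_(E j) w)%:E = h%:E * P (E j))%E.
  under eq_integral do rewrite EFinM.
  rewrite ge0_integralZl ?lee_fin ?(ltW h0)//; last first.
    exact/measurable_EFinP.
  by rewrite integral_indic// setIT.
under eq_eseriesr do rewrite intE.
apply: lime_le.
  by apply: is_cvg_nneseries => j _ _; rewrite mule_ge0// lee_fin ltW.
apply: nearW => J; rewrite big_mkord.
case: J => [|J].
  by rewrite big_ord0 lee_fin; have := mulr_ge0 C0 (ltW h0); lra.
rewrite big_ord_recl /=.
have -> : ((1 + 2 * C) * h)%:E = (h * 1 + h * (C * 2))%:E by congr EFin; ring.
rewrite EFinD; apply: leeD.
  by rewrite EFinM lee_pmul2l ?lte_fin//; exact: probability_le1.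
apply: (@le_trans _ _ (\sum_(j < J) (h * (C * j.+1%:R ^- 2))%:E)%E).
  apply: lee_sum => j _; rewrite EFinM lee_pmul2l ?lte_fin//; exact: PE.
rewrite sumEFin lee_fin -!mulr_sumr ler_pM2l// ler_wpM2l//.
exact: inverse_squares_sum_le.
Qed.

End BrownianIncrements.

(** * Almost sure properties of Brownian paths *)

Section CommonSubsequence.
Context (R : realType) (d : measure_display) (T : measurableType d).
Variable P : probability T R.

(** Diagonal extraction: countably many sequences converging to 0 in probability
    converge almost surely along one and the same sequence of levels. *)
Lemma common_subsequence (U : nat -> nat -> T -> R) :
  (forall e n, measurable_fun setT (U e n)) ->
  (forall e (a q : R), 0 < a -> 0 < q -> exists n0, forall n, (n0 <= n)%N ->
    (P [set w | (a <= `|U e n w|)%R] < q%:E)%E) ->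
  exists nl : nat -> nat, (forall l, (l <= nl l)%N) /\
    {ae P, forall w, forall e, (fun l => U e (nl l) w) @ \oo --> 0}.
Proof.
move=> mU cU.
have /choice[nl Hnl] : forall l, exists n, (l <= n)%N /\ forall e, (e <= l)%N ->
    (P [set w | (2 ^- l <= `|U e n w|)%R] < (2 ^- l)%:E)%E.
  move=> l; have /choice[n0 Hn0] e := cU e _ _ (exp2N_gt0 R l) (exp2N_gt0 R l).
  exists (l + \max_(e < l.+1) n0 e)%N; split; first exact: leq_addr.
  move=> e el; apply: Hn0; apply: leq_trans (leq_addl _ _).
  exact: (@leq_bigmax _ (fun e : 'I_l.+1 => n0 e) (Ordinal (el : e < l.+1)%N)).
exists nl; split; first by move=> l; exact: (Hnl l).1.
apply/ae_foralln => e.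
pose F l := if (e <= l)%N then [set w | (2 ^- l <= `|U e (nl l) w|)%R] else set0.
have h2 : 0 <= 2^-1 :> R by [].
have h21 : 2^-1 < 1 :> R by lra.
have mF l : measurable (F l).
  rewrite /F; case: ifP => // _; apply: measurable_superlevel.
  exact: measurableT_comp.
have PF l : (P (F l) <= (1 * 2^-1 ^+ l)%:E)%E.
  rewrite /F mul1r exprVn; case: ifP => [el|_]; first exact/ltW/(Hnl l).2.
  by rewrite measure0 lee_fin ltW// exp2N_gt0.
have := borel_cantelli_geometric ler01 h2 h21 mF PF.
apply: filterS => w [n0 Hw]; apply/cvgr0Pnorm_le => x x0.
have [n1 n1x] := exp2N_small x0.
near=> l.
have nl0 : (maxn e (maxn n0 n1) <= l)%N by near: l; exact: nbhs_infty_ge.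
have := Hw l ltac:(lia); rewrite /F ifT; last by lia.
move=> /negP; rewrite -ltNge => /ltW /le_trans; apply.
by apply: le_trans n1x; apply: le_exp2N; lia.
Unshelve. all: by end_near. Qed.

End CommonSubsequence.

Section DyadicPartitions.
Context (R : realType).

Definition dyadic_partition (n N : nat) : seq R := [seq dyad R n k.+1 | k <- iota 0 N].

Lemma size_dyadic_partition n N : size (dyadic_partition n N) = N.
Proof. by rewrite size_map size_iota. Qed.

Lemma nth_dyadic_partition x0 n N k : (k <= N)%N ->
  nth x0 (0 :: dyadic_partition n N) k = dyad R n k.
Proof.
case: k => [|k] kN; first by rewrite /= dyad0.
by rewrite /= (nth_map 0%N) ?size_iota// nth_iota.
Qed.

Lemma dyadic_partitionP n N :
  itv_partition 0 (dyad R n N) (dyadic_partition n N).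
Proof.
split.
  apply/(pathP 0) => k; rewrite size_dyadic_partition => kN.
  rewrite nth_dyadic_partition ?(ltnW kN)//.
  have := nth_dyadic_partition 0 n kN; rewrite /= => ->.
  exact: dyad_lt.
by rewrite (last_nth 0) size_dyadic_partition nth_dyadic_partition.
Qed.

Lemma dyadic_partition_mesh n N h : 2 ^- n < h ->
  mesh_lt (dyad R n N) (dyadic_partition n N) h.
Proof.
rewrite /mesh_lt => nh k; rewrite size_dyadic_partition => kN.
by rewrite !nth_dyadic_partition ?(ltnW kN)// dyad_step.
Qed.

Lemma riemann_sum_dyadic sense y b n N :
  riemann_sum sense y b (dyad R n N) (dyadic_partition n N) =
  dyadic_riemann_sum sense y b n N.
Proof.
rewrite /riemann_sum /dyadic_riemann_sum size_dyadic_partition.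
apply: eq_bigr => k _; have kN := ltn_ord k.
by rewrite !nth_dyadic_partition// ltnW.
Qed.

End DyadicPartitions.

Section IteratedIntegralLimits.
Context (R : realType) (d : measure_display) (T : measurableType d).
Variables (P : probability T R) (B : R -> T -> R) (sense : integration_sense).
Hypothesis bm : standard_brownian_motion P B.
Variable X : seq 'I_2 -> R -> T -> R.
Hypothesis XP : is_iterated_integrals sense P B X.

Let mB t : 0 <= t -> measurable_fun setT (B t).
Proof. by have [+ _ _ _ _] := bm; exact. Qed.

Lemma iterated_integral_levels : exists nl : nat -> nat,
  (forall l, (l <= nl l)%N) /\
  {ae P, forall w, forall I m i,
    (fun l => dyadic_riemann_sum sense (X I ^~ w) (B ^~ w) (nl l)
      (i * 2 ^ (nl l - m))) @ \oo --> X (rcons I ord_max) (dyad R m i) w}.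
Proof.
pose V I m i n w := dyadic_riemann_sum sense (X I ^~ w) (B ^~ w) n (i * 2 ^ (n - m))
  - X (rcons I ord_max) (dyad R m i) w.
pose U e n w := if @unpickle (seq 'I_2 * nat * nat)%type e is Some (J, m, i) then V J m i n w else 0.
have mX I t : 0 <= t -> measurable_fun setT (X I t) :=
  iterated_integral_measurable XP I (t := t).
have mU e n : measurable_fun setT (U e n).
  rewrite /U; case: unpickle => [[[I m] i]|]; last exact: measurable_cst.
  apply: measurable_funB; last by apply: mX; exact: dyad_ge0.
  apply: measurable_sum => k; apply: measurable_funM; last first.
    by apply: measurable_funB; apply: mB; exact: dyad_ge0.
  case: (sense) => /=; first by apply: mX; exact: dyad_ge0.
  by apply: measurable_funM => //; apply: measurable_funD; apply: mX; exact: dyad_ge0.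
have PU (e : nat) (a q : R) : 0 < a -> 0 < q -> exists n0, forall n, (n0 <= n)%N ->
    (P [set w | (a <= `|U e n w|)%R] < q%:E)%E.
  move=> a0 q0; rewrite /U; case: unpickle => [[[I m] i]|]; last first.
    exists 0%N => n _; rewrite (_ : [set w | _] = set0) ?measure0//.
    by apply/seteqP; split=> // w /=; rewrite normr0 leNgt a0.
  have [h h0 Hh] := iterated_integral_dB XP I (dyad_ge0 R m i) a0 q0.
  have [n0 Hn0] := @exp2N_small R (h / 2) ltac:(by rewrite divr_gt0).
  exists (maxn m n0) => n; rewrite geq_max => /andP[mn n0n].
  have := Hh (dyadic_partition R n (i * 2 ^ (n - m))).
  rewrite -(dyad_refine R i mn) => /(_ (dyadic_partitionP _ _ _)).
  have nh : 2 ^- n < h by have := le_exp2N R n0n; lra.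
  move=> /(_ (dyadic_partition_mesh nh)).
  by rewrite /V -(dyad_refine R i mn); under eq_set do rewrite riemann_sum_dyadic.
have [nl [nlP cU]] := common_subsequence mU PU.
exists nl; split => //; move: cU; apply: filterS => w Hw I m i.
have := Hw (pickle (I, m, i)); rewrite /U pickleK /V => h.
have := cvgD h (@cvg_cst _ (X (rcons I ord_max) (dyad R m i) w) _ \oo _).
rewrite add0r => h'; apply: cvg_trans (h' _ _); apply: near_eq_cvg.
by near=> l; rewrite !fctE subrK.
Unshelve. all: by end_near. Qed.

End IteratedIntegralLimits.

Section PathwiseChaining.
Context (R : realType).

Lemma chaining_dyadic (b : R -> R) (lam : R) n0 m : b 0 = 0 -> 0 <= lam ->
  (forall n, (n0 <= n)%N -> forall k, (k < 2 ^ n)%N ->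
    `|b (dyad R n k.+1) - b (dyad R n k)| <= lam ^+ n) -> (n0 <= m)%N ->
  forall j k, (k <= 2 ^ j)%N ->
  `|b (dyad R (m + j) k)| <= lam ^+ m * \sum_(i < j.+1) lam ^+ i.
Proof.
move=> b0 l0 inc n0m; elim=> [|j IH] k kj.
  rewrite addn0 big_ord_recl big_ord0 addr0 expr0 mulr1.
  case: k kj => [|[|//]] _; first by rewrite dyad0 b0 normr0 exprn_ge0.
  have := inc m n0m 0%N ltac:(by rewrite expn_gt0).
  by rewrite dyad0 b0 subr0.
rewrite addnS big_ord_recr /= mulrDr -exprD.
have p2 : 0 <= lam ^+ (m + j.+1) by rewrite exprn_ge0.
have half_le : (k./2 <= 2 ^ j)%N by move: kj; rewrite expnS; lia.
rewrite -{1}(odd_double_half k); case: (boolP (odd k)) => ok; last first.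
  by rewrite add0n dyad_double; apply: le_trans (IH _ half_le) _; rewrite lerDl.
rewrite add1n.
have := inc (m + j).+1 ltac:(lia) (k./2).*2.
have lt2 : ((k./2).*2 < 2 ^ (m + j).+1)%N.
  apply: (@leq_trans (2 ^ j.+1)); first by move: kj; rewrite -{1}(odd_double_half k) ok.
  by rewrite leq_pexp2l//; lia.
move=> /(_ lt2); rewrite dyad_double => inc1.
rewrite -[b _](subrK (b (dyad R (m + j) k./2))) addrC.
apply: le_trans (ler_normD _ _) (lerD (IH _ half_le) _).
by rewrite addnS.
Qed.

(** The dyadic expansion of [t] leads from 0 to [t] through at most one increment
    of each level from [m] on, whence a geometric series. *)
Lemma chaining (b : R -> R) (lam : R) n0 m t : ucont b -> b 0 = 0 ->
  0 <= lam -> lam < 1 ->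
  (forall n, (n0 <= n)%N -> forall k, (k < 2 ^ n)%N ->
    `|b (dyad R n k.+1) - b (dyad R n k)| <= lam ^+ n) -> (n0 <= m)%N ->
  0 <= t <= 2 ^- m -> `|b t| <= lam ^+ m / (1 - lam).
Proof.
move=> cb b0 l0 l1 inc n0m /andP[t0 tm].
have m1 : 2 ^- m <= 1 :> R by have := le_exp2N R (leq0n m); rewrite expr0 invr1.
have t01 : 0 <= t <= 1 by rewrite t0 (le_trans tm).
apply/ler_addgt0Pl => e e0; have [j Hj] := cb.2 _ e0.
have [k _ [kt tk]] := dyadic_below (m + j) t01.
have kj : (k <= 2 ^ j)%N.
  have : k%:R / 2 ^+ (m + j) <= 2 ^- m :> R by exact: le_trans tm.
  rewrite ler_pdivrMr ?exprn_gt0// exprD mulKf ?expf_neq0//.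
  by rewrite -natrX ler_nat.
have := chaining_dyadic b0 l0 inc n0m kj.
rewrite -[b t](subrK (b (dyad R (m + j) k))) => h.
apply: le_trans (ler_normD _ _) _; apply: lerD.
  apply: Hj => //; first exact: dyad_ge0.
    by case/andP: t01.
  by apply: le_trans tk _; apply: le_exp2N; exact: leq_addl.
apply: le_trans h _; rewrite ler_wpM2l ?exprn_ge0//.
exact: geometric_partial_sum_le.
Qed.

Lemma cubic_sum_cvg0 (b : R -> R) (lam : R) n0 :
  0 <= lam -> 2 * lam ^+ 3 < 1 ->
  (forall n, (n0 <= n)%N -> forall k, (k < 2 ^ n)%N ->
    `|b (dyad R n k.+1) - b (dyad R n k)| <= lam ^+ n) ->
  (fun n => \sum_(k < 2 ^ n) `|b (dyad R n k.+1) - b (dyad R n k)| ^+ 3)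
    @ \oo --> 0.
Proof.
move=> l0 l3 inc; have q0 : 0 <= 2 * lam ^+ 3 by rewrite mulr_ge0// exprn_ge0.
have geo : (fun n => (2 * lam ^+ 3) ^+ n) @ \oo --> 0.
  by apply: cvg_expr; rewrite ger0_norm.
apply: (@squeeze_cvgr _ _ _ _ (fun=> 0) (fun n => (2 * lam ^+ 3) ^+ n)) => //.
  near=> n; have nn : (n0 <= n)%N by near: n; exact: nbhs_infty_ge.
  rewrite sumr_ge0//=.
  apply: (@le_trans _ _ (\sum_(k < 2 ^ n) (lam ^+ n) ^+ 3)).
    by apply: ler_sum => k _; rewrite lerXn2r ?nnegrE ?exprn_ge0// inc.
  rewrite sumr_const card_ord -[leLHS]mulr_natl natrX exprMn.
  by rewrite -!exprM mulnC.
exact: cvg_cst.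
Unshelve. all: by end_near. Qed.

(** Sums of squares grow with the interval, which settles the dyadic points;
    continuity does the rest. *)
Lemma bracket_monotone (b A : R -> R) (nl : nat -> nat) : ucont A ->
  (forall m i, (i <= 2 ^ m)%N ->
      (fun l => \sum_(k < i * 2 ^ (nl l - m))
         (b (dyad R (nl l) k.+1) - b (dyad R (nl l) k)) ^+ 2) @ \oo
      --> A (dyad R m i)) ->
  forall s u, 0 <= s -> s <= u -> u <= 1 -> A s <= A u.
Proof.
move=> cA qv s u s0; rewrite le_eqVlt => /predU1P[->//|su] u1.
have dyadic_mono m i j : (i <= j)%N -> (j <= 2 ^ m)%N ->
    A (dyad R m i) <= A (dyad R m j).
  move=> ij jm; have := qv m j jm; have := qv m i (leq_trans ij jm) => qi qj.
  apply: (ler_cvg_to qi qj); near=> l.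
  apply: (@sum_widen_le _ (fun k => (b (dyad R (nl l) k.+1)
    - b (dyad R (nl l) k)) ^+ 2)); last by rewrite leq_mul2r ij orbT.
  by move=> k; exact: sqr_ge0.
apply/ler_addgt0Pl => e e0.
have [n Hn] := cA.2 (e / 2) ltac:(by rewrite divr_gt0).
have [i i2 [si is_]] := @dyadic_below R n s ltac:(lra).
have [j j2 [uj ju]] := @dyadic_below R n u ltac:(lra).
have Aij : A (dyad R n i) <= A (dyad R n j).
  have [ij|ji] := leqP i j; first exact: dyadic_mono.
  (* otherwise [u] would not exceed [s] *)
  exfalso; have : dyad R n j.+1 <= dyad R n i.
    by rewrite ler_pM2r ?invr_gt0 ?exprn_gt0// ler_nat.
  have := dyad_step R n j; rewrite -/(dyad R n i) -/(dyad R n j) in si ju *.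
  lra.
have As := Hn _ _ (dyad_ge0 R n i) si ltac:(lra) is_.
have Au := Hn _ _ (dyad_ge0 R n j) uj u1 ju.
move: As Au; rewrite !ler_norml => /andP[_ ?] /andP[? _]; lra.
Unshelve. all: by end_near. Qed.

End PathwiseChaining.

Section BrownianPaths.
Context (R : realType) (d : measure_display) (T : measurableType d).
Variables (P : probability T R) (B : R -> T -> R).
Hypothesis bm : standard_brownian_motion P B.

Let mB t : 0 <= t -> measurable_fun setT (B t).
Proof. by have [+ _ _ _ _] := bm; exact. Qed.

Lemma dyadic_increments_ae (lam : R) : 0 < lam -> 1 < 2 * lam ^+ 2 ->
  {ae P, forall w, exists n0, forall n, (n0 <= n)%N -> forall k, (k < 2 ^ n)%N ->
    `|B (dyad R n k.+1) w - B (dyad R n k) w| <= lam ^+ n}.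
Proof.
move=> l0 l2; pose th := (2 * lam ^+ 2)^-1.
have th0 : 0 < th by rewrite invr_gt0; lra.
have th1 : th < 1 by rewrite invf_lt1//; lra.
(* a moment high enough to beat the number of cells *)
have [p thp] : exists p : nat, th ^+ p.+1 <= 4^-1.
  have : (fun n => th ^+ n) @ \oo --> 0.
    by apply: cvg_expr; rewrite gtr0_norm.
  move=> /cvgr0Pnorm_le/(_ 4^-1 ltac:(by [])) [n _ /(_ n.+1 (leqnSn n))].
  by rewrite ger0_norm ?exprn_ge0 ?(ltW th0)// => h; exists n.
set C := gaussian_tail_constant R p.+1.
have C0 : 0 <= C by rewrite !mulr_ge0// exprn_ge0.
pose E n k := [set w | (lam ^+ n <= `|B (dyad R n k.+1) w - B (dyad R n k) w|)%R].
pose F n := \big[setU/set0]_(k < 2 ^ n) E n k.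
have mE n k : measurable (E n k).
  apply: measurable_superlevel; apply: measurableT_comp => //.
  by apply: measurable_funB; apply: mB; exact: dyad_ge0.
have mF n : measurable (F n) by apply: bigsetU_measurable => k _; exact: mE.
have PF n : (P (F n) <= (C * 2^-1 ^+ n)%:E)%E.
  apply: le_trans (Boole_inequality _ _) _ => //.
  apply: (@le_trans _ _ (\sum_(k < 2 ^ n) (C * (th ^+ n * 2 ^+ n / 2 ^+ n) ^+ p.+1)%:E)%E).
    apply: lee_sum => k _.
    apply: le_trans (brownian_increment_tail bm p (dyad_ge0 R n k) (dyad_lt R n k)
      (exprn_gt0 n l0)) _.
    rewrite lee_fin ler_wpM2l//.
    have -> : (dyad R n k.+1 - dyad R n k) / (lam ^+ n) ^+ 2 = th ^+ n * 2 ^+ n / 2 ^+ n.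
      rewrite dyad_step mulfK ?expf_neq0// /th exprVn [in RHS]exprMn [in RHS]invfM.
      by rewrite -!exprM mulnC.
    by [].
  rewrite sumEFin lee_fin sumr_const card_ord mulfK ?expf_neq0//.
  rewrite -[leLHS]mulr_natr -mulrA ler_wpM2l// natrX -exprM mulnC exprM -exprMn.
  apply: lerXn2r; rewrite ?nnegrE ?mulr_ge0 ?exprn_ge0 ?(ltW th0)//; lra.
have h2 : 0 <= 2^-1 :> R by [].
have h21 : 2^-1 < 1 :> R by lra.
have := borel_cantelli_geometric C0 h2 h21 mF PF.
apply: filterS => w [n0 Hw]; exists n0 => n n0n k kn.
rewrite leNgt; apply/negP => /ltW h; apply: (Hw n n0n).
by rewrite /F -bigcup_mkord; exists k.
Qed.

Let Q n N w := \sum_(k < N) (B (dyad R n k.+1) w - B (dyad R n k) w) ^+ 2.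

Let mQ n N : measurable_fun setT (Q n N).
Proof.
apply: measurable_sum => k; apply: measurable_funX.
by apply: measurable_funB; apply: mB; exact: dyad_ge0.
Qed.

Lemma quadratic_sum_tail : exists2 K : R, 0 <= K & forall n N (c : R), 0 < c ->
  (P [set w | (c <= Q n N w)%R] <= (K * (dyad R n N / c))%:E)%E.
Proof.
have [K K0 HK] := brownian_increment_sqr bm; exists K => // n N c c0.
set S := [set w | _].
have mS : measurable S by exact: measurable_superlevel (mQ _ _).
have Q0 w : 0 <= Q n N w by apply: sumr_ge0 => k _; exact: sqr_ge0.
have EQ : (\int[P]_w (Q n N w)%:E <= (K * dyad R n N)%:E)%E.
  under eq_integral do rewrite /Q -sumEFin.
  rewrite ge0_integral_sum//; last 2 first.
  - move=> k; apply/measurable_EFinP/measurable_funX.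
    by apply: measurable_funB; apply: mB; exact: dyad_ge0.
  - by move=> k w _; rewrite lee_fin sqr_ge0.
  apply: (@le_trans _ _ (\sum_(k < N) (K * (dyad R n k.+1 - dyad R n k))%:E)%E).
    by apply: lee_sum => k _; apply: HK; [exact: dyad_ge0|exact: dyad_lt].
  by rewrite sumEFin lee_fin -mulr_sumr (dyad_telescope id) subr0.
have : (c%:E * P S <= (K * dyad R n N)%:E)%E.
  apply: le_trans EQ; rewrite -(setIT S) -integral_indic// -ge0_integralZl ?lee_fin ?(ltW c0)//; last first.
    exact/measurable_EFinP.
  apply: ge0_le_integral => //.
  - by move=> w _; rewrite -EFinM lee_fin mulr_ge0// ltW.
  - apply: emeasurable_funM => //.
    exact/measurable_EFinP.
  - by apply/measurable_EFinP.
  - move=> w _; rewrite -EFinM lee_fin indicE.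
    have [wS|_] := boolP (w \in S); last by rewrite mulr0.
    by rewrite mulr1; move/set_mem: wS.
by rewrite -lee_pdivlMl// -EFinM mulrC mulrA.
Qed.

(** The sums of squares up to time [2^-m] have means of order [2^-m], so by the
    Markov inequality their limit exceeds [lam^(2m)] with a probability that
    decays geometrically in [m]. *)
Lemma quadratic_variation_ae (lam : R) (nl : nat -> nat) :
  0 < lam -> 1 < 2 * lam ^+ 2 -> (forall l, (l <= nl l)%N) ->
  {ae P, forall w, exists m0, forall m, (m0 <= m)%N -> forall a : R,
    (fun l => Q (nl l) (1 * 2 ^ (nl l - m)) w) @ \oo --> a ->
    a <= (lam ^+ 2) ^+ m}.
Proof.
move=> l0 l2 nlP; have [K K0 HK] := quadratic_sum_tail.
pose th := (2 * lam ^+ 2)^-1.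
have th0 : 0 < th by rewrite invr_gt0; lra.
have th1 : th < 1 by rewrite invf_lt1//; lra.
have c0 m : 0 < (lam ^+ 2) ^+ m by rewrite !exprn_gt0.
pose E m l := [set w |
  ((lam ^+ 2) ^+ m <= Q (nl (l + m)) (1 * 2 ^ (nl (l + m) - m)) w)%R].
pose H m l := \bigcap_(l' >= l) E m l'.
pose F m := \bigcup_l H m l.
have mE m l : measurable (E m l) by exact: measurable_superlevel (mQ _ _).
have mH m l : measurable (H m l) by apply: bigcap_measurable => [|k _]; [exists l => /=|exact: mE].
have mF m : measurable (F m) by apply: bigcup_measurable => k _; exact: mH.
have PH m l : (P (H m l) <= (K * th ^+ m)%:E)%E.
  apply: (@le_trans _ _ (P (E m l))).
    by apply: le_measure; rewrite ?inE// => w; apply => /=.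
  apply: le_trans (HK _ _ _ (c0 m)) _; rewrite lee_fin dyad_refine; last first.
    by apply: leq_trans (nlP _); exact: leq_addl.
  have -> : dyad R m 1 / (lam ^+ 2) ^+ m = th ^+ m; last by [].
  by rewrite /dyad div1r /th exprVn [in RHS]exprMn [in RHS]invfM.
have PF m : (P (F m) <= (K * th ^+ m)%:E)%E.
  have cF := nondecreasing_cvg_mu (mu := P) (mH m) (mF m).
  have /cF/cvg_lim <- // : nondecreasing_seq (H m).
    apply/nondecreasing_seqP => l; apply/subsetPset => w Hw k /= lk.
    by apply: Hw => /=; exact: ltnW.
  apply: lime_le.
    apply/cvg_ex; exists (P (F m)); apply: cF.
    apply/nondecreasing_seqP => l; apply/subsetPset => w Hw k /= lk.
    by apply: Hw => /=; exact: ltnW.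
  by apply: nearW => l; exact: PH.
have := borel_cantelli_geometric K0 (ltW th0) th1 mF PF.
apply: filterS => w [m0 Hw]; exists m0 => m m0m a Qa.
rewrite leNgt; apply/negP => alt; apply: (Hw m m0m).
have := cvgr_ge _ Qa _ alt; move=> [l _ Hl].
exists l => // k /= lk; rewrite /E /=; apply: Hl => /=.
by apply: leq_trans lk _; exact: leq_addr.
Qed.

End BrownianPaths.

Lemma ae_forall_countable d (T : measurableType d) (R : realType)
    (P : probability T R) (I : countType) (Q : I -> T -> Prop) :
  (forall i, {ae P, forall w, Q i w}) -> {ae P, forall w, forall i, Q i w}.
Proof.
move=> aQ; have : {ae P, forall w, forall n : nat,
    if unpickle n is Some i then Q i w else True}.
  apply/ae_foralln => n; case: (unpickle n) => [i|]; first exact: aQ.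
  exact: filterE.
by apply: filterS => w Hw i; have := Hw (pickle i); rewrite pickleK.
Qed.

(** For left-endpoint sums, [b^2 - 2 int b db] is the limit of the sums of
    squared increments, by summation by parts. *)
Lemma square_bracket (R : realType) (b : R -> R) (x : seq 'I_2 -> R -> R) (nl : nat -> nat) :
  (forall l, (l <= nl l)%N) -> b 0 = 0 ->
  (forall t, 0 <= t -> x [::] t = 1) ->
  (forall I m i, (fun l => dyadic_riemann_sum Ito (x I) b (nl l)
      (i * 2 ^ (nl l - m))) @ \oo --> x (rcons I ord_max) (dyad R m i)) ->
  forall m i, (fun l => \sum_(k < i * 2 ^ (nl l - m))
         (b (dyad R (nl l) k.+1) - b (dyad R (nl l) k)) ^+ 2) @ \oo
      --> b (dyad R m i) ^+ 2 - 2 * x [:: ord_max; ord_max] (dyad R m i).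
Proof.
move=> nlP b0 x0 cx.
have xb m i : x [:: ord_max] (dyad R m i) = b (dyad R m i).
  have := cx [::] m i => /= c1.
  have E : \forall l \near \oo, b (dyad R m i) =
      dyadic_riemann_sum Ito (x [::]) b (nl l) (i * 2 ^ (nl l - m)).
    near=> l; have ml : (m <= nl l)%N.
      by apply: leq_trans (nlP l); near: l; exact: nbhs_infty_ge.
    rewrite /dyadic_riemann_sum /=.
    under eq_bigr do rewrite x0 ?dyad_ge0// mul1r.
    by rewrite dyad_telescope b0 subr0 dyad_refine.
  have c2 := cvg_trans (near_eq_cvg E) (@cvg_cst _ (b (dyad R m i)) _ \oo _).
  by rewrite -(cvg_lim (@Rhausdorff R) c1) (cvg_lim (@Rhausdorff R) (c2 _ _)).
move=> m i; have c2 := cx [:: ord_max] m i.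
have c3 : (fun l => b (dyad R m i) ^+ 2 - 2 * dyadic_riemann_sum Ito (x [:: ord_max]) b
      (nl l) (i * 2 ^ (nl l - m))) @ \oo -->
    b (dyad R m i) ^+ 2 - 2 * x [:: ord_max; ord_max] (dyad R m i).
  by apply: cvgB; [exact: cvg_cst|apply: cvgM; [exact: cvg_cst|exact: c2]].
apply: cvg_trans c3; apply: near_eq_cvg; near=> l.
have ml : (m <= nl l)%N.
  by apply: leq_trans (nlP l); near: l; exact: nbhs_infty_ge.
rewrite -(dyad_refine R i ml) /dyadic_riemann_sum /=.
set N := (i * _)%N; move: N => N; elim: N => [|N IH].
  by rewrite !big_ord0 dyad0 b0 mulr0 subr0 expr0n.
by rewrite !big_ord_recr /= -IH xb; ring.
Unshelve. all: by end_near. Qed.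

Section DrivingPaths.
Context (R : realType) (d : measure_display) (T : measurableType d).
Variables (P : probability T R) (B : R -> T -> R) (sense : integration_sense).
Hypothesis bm : standard_brownian_motion P B.
Variable X : seq 'I_2 -> R -> T -> R.
Hypothesis XP : is_iterated_integrals sense P B X.

(** Everything random that the pathwise analysis uses, on one event of
    probability one. The bracket is read off from the iterated integrals
    themselves: in the left-endpoint case the existence of the integral of [B]
    against itself makes the sums of squares converge, and in the trapezoidal
    case the bracket is 0. *)
Lemma driving_path_ae (lam : R) : 0 < lam -> 1 < 2 * lam ^+ 2 ->
  2 * lam ^+ 3 < 1 ->
  {ae P, forall w, exists A nl, [/\ driving_path sense (B ^~ w) A nl,
    forall I, parabolic_order (B ^~ w) A (parabolic_weight I) (X I ^~ w),
    forall t, 0 <= t <= 1 -> X [::] t w = 1 &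
    exists K m0, [/\ 1 <= K, (1 <= m0)%N & forall m t, (m0 <= m)%N -> 0 <= t <= 2 ^- m ->
      `|B t w| <= K * lam ^+ m /\ `|A t| <= (K * lam ^+ m) ^+ 2]]}.
Proof.
move=> l0 l2 l3.
have l1 : lam < 1.
  rewrite ltNge; apply/negP => l1.
  have : 1 <= lam ^+ 3 by rewrite exprn_ege1.
  lra.
have [nl [nlP levels]] := iterated_integral_levels bm XP.
have [_ B0 _ _ cB] := bm.
have incs := dyadic_increments_ae bm l0 l2.
have qvs := quadratic_variation_ae bm l0 l2 nlP.
have cX : {ae P, forall w, forall I, ucont (X I ^~ w)}.
  apply: ae_forall_countable => J; have := iterated_integral_continuous XP J.
  by apply: filterS => w; exact: within_ucont.
have Xdt : {ae P, forall w, forall I t, 0 <= t -> X (rcons I ord0) t w =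
      \int[lebesgue_measure]_(s in `[0, t]) X I s w}.
  by apply: ae_forall_countable => J; exact: iterated_integral_dt XP J.
have X0 := iterated_integral_nil XP.
near=> w.
have cBw : ucont (B ^~ w) by apply: within_ucont; near: w.
have B0w : B 0 w = 0 by near: w.
have [n0 inc] : exists n0, forall n, (n0 <= n)%N -> forall k, (k < 2 ^ n)%N ->
    `|B (dyad R n k.+1) w - B (dyad R n k) w| <= lam ^+ n by near: w.
have [m1 qv] : exists m1, forall m, (m1 <= m)%N -> forall a : R,
    (fun l => \sum_(k < 1 * 2 ^ (nl l - m))
      (B (dyad R (nl l) k.+1) w - B (dyad R (nl l) k) w) ^+ 2) @ \oo --> a ->
    a <= (lam ^+ 2) ^+ m by near: w.
have cXw : forall I, ucont (X I ^~ w) by near: w.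
have Xdtw : forall I t, 0 <= t -> X (rcons I ord0) t w =
      \int[lebesgue_measure]_(s in `[0, t]) X I s w by near: w.
have X0w : forall t, 0 <= t -> X [::] t w = 1 by near: w.
have lev : forall I m i,
    (fun l => dyadic_riemann_sum sense (X I ^~ w) (B ^~ w) (nl l)
      (i * 2 ^ (nl l - m))) @ \oo --> X (rcons I ord_max) (dyad R m i) w by near: w.
have X0w1 t : 0 <= t <= 1 -> X [::] t w = 1 by move=> /andP[? _]; exact: X0w.
pose A t := if sense is Ito then B t w ^+ 2 - 2 * X [:: ord_max; ord_max] t w else 0.
have cA : ucont A.
  rewrite /A; case: (sense); last exact: ucont_cst.
  apply: ucontD; first exact: ucontX.
  by apply: ucontN; apply: ucontM => //; exact: ucont_cst.
have qA : sense = Ito -> forall m i, (fun l => \sum_(k < i * 2 ^ (nl l - m))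
    (B (dyad R (nl l) k.+1) w - B (dyad R (nl l) k) w) ^+ 2) @ \oo --> A (dyad R m i).
  move=> sI; rewrite /A sI; apply: (square_bracket (b := B ^~ w) (x := fun I => X I ^~ w)) => //.
  by move=> I m i; have := lev I m i; rewrite sI.
have senseP : {sense = Ito} + {sense = Stratonovich}.
  by case: (sense); [left|right].
have A_S : sense = Stratonovich -> forall t, A t = 0 by rewrite /A => ->.
have A_mono s u : 0 <= s -> s <= u -> u <= 1 -> A s <= A u.
  case: senseP => [sI|sS]; last by rewrite !(A_S sS).
  by apply: (bracket_monotone cA (b := B ^~ w) (nl := nl)) => m i _; exact: qA.
have A0 : A 0 = 0.
  case: senseP => [sI|sS]; last exact: A_S.
  have := qA sI 0%N 0%N; rewrite dyad0 => /(cvg_lim (@Rhausdorff R)) <-.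
  under eq_fun do rewrite mul0n big_ord0.
  by rewrite lim_cst.
have dp : driving_path sense (B ^~ w) A nl.
  split => //; first exact: (cubic_sum_cvg0 (b := B ^~ w) (ltW l0) l3 inc).
  case: senseP => [sI|sS]; last by rewrite sS; apply/funext => t; exact: A_S.
  by rewrite sI => m i _; exact: qA.
have Xord I : parabolic_order (B ^~ w) A (parabolic_weight I) (X I ^~ w).
  apply: (word_order dp (X := fun I t => X I t w)) => //.
  by move=> J t /andP[? _]; exact: Xdtw.
exists A, nl; split => //.
have K1 : 1 <= (1 - lam)^-1 by rewrite invf_ge1; lra.
set K := (1 - lam)^-1 in K1 *.
exists K, (maxn 1 (maxn n0 m1)); split => //; first exact: leq_maxl.
move=> m t; rewrite !geq_max => /and3P[m_1 n0m m1m] /[dup] t2m /andP[t0 tm].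
have m1' : 2 ^- m <= 1 :> R by have := le_exp2N R (leq0n m); rewrite expr0 invr1.
split.
  rewrite mulrC; exact: (chaining (b := B ^~ w)) cBw B0w (ltW l0) l1 inc n0m t2m.
have A0t : 0 <= A t by rewrite -A0 A_mono// (le_trans tm).
rewrite ger0_norm//; apply: (@le_trans _ _ ((lam ^+ 2) ^+ m)).
  case: senseP => [sI|sS]; last by rewrite (A_S sS) !exprn_ge0// ltW.
  apply: le_trans (A_mono _ _ t0 tm m1') _.
  have := qv m m1m _ (qA sI m 1%N); rewrite /dyad div1r; exact.
have -> : (K * lam ^+ m) ^+ 2 = K ^+ 2 * (lam ^+ 2) ^+ m.
  by rewrite [LHS]exprMn [X in _ * X]exprAC.
by rewrite ler_peMl ?exprn_ge0 ?(ltW l0)// exprn_ege1.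
Unshelve. all: by end_near. Qed.

End DrivingPaths.

(** * Choice of scales *)

Section ScalingExponents.
Context (R : realType).

(** Three demands on a Holder exponent: below 1/2 for Brownian paths to have it,
    above 1/3 for the cubic variation to vanish, and close enough to 1/2 for the
    path to be [o(eps)] up to time [eps ^ (2 + delta)]. *)
Lemma holder_exponent (delta : R) : 0 < delta ->
  exists beta : R, [/\ 1 < 3 * beta, 2 * beta < 1 & 1 < (2 + delta) * beta].
Proof.
move=> d0; pose e := Num.min delta 1.
have e0 : 0 < e by rewrite lt_min d0 ltr01.
have e1 : e <= 1 by rewrite ge_min lexx orbT.
have ed : e <= delta by rewrite ge_min lexx.
pose c := (2 + e)^-1; have e20 : 0 < 2 + e by lra.
have c0 : 0 < c by rewrite invr_gt0.
have cE : (2 + e) * c = 1 by rewrite divff// gt_eqF.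
have c13 : 1 <= 3 * c by rewrite -cE ler_pM2r//; lra.
have c12 : 2 * c < 1 by rewrite -cE ltr_pM2r//; lra.
exists ((2^-1 + c) / 2); split; [lra|lra|].
apply: (@lt_le_trans _ _ ((2 + e) * ((2^-1 + c) / 2))).
  have -> : (2 + e) * ((2^-1 + c) / 2) = (2 + e) / 4 + (2 + e) * c / 2 by field.
  by rewrite cE; lra.
by rewrite ler_wpM2r//; lra.
Qed.

Lemma powR_small (a e : R) : 0 < a -> 0 < e -> exists2 eta : R, 0 < eta &
  forall x, 0 < x -> x < eta -> x `^ a <= e.
Proof.
move=> a0 e0; exists (e `^ a^-1); first exact: powR_gt0.
move=> x x0 /ltW xe.
have -> : e = (e `^ a^-1) `^ a.
  by rewrite -powRrM mulVf ?gt_eqF// powRr1// ltW.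
by apply: ge0_ler_powR; rewrite ?nnegrE ?powR_ge0// ltW.
Qed.

Lemma dyadic_scale (x : R) (m0 : nat) : 0 < x -> x <= 2 ^- m0 ->
  exists m, [/\ (m0 <= m)%N, x <= 2 ^- m & 2 ^- m <= 2 * x].
Proof.
move=> x0 xm0; have [k0 Hk0] := @exp2N_small R (x / 2) ltac:(by rewrite divr_gt0).
have ex : exists k, 2 ^- k < x by exists k0; lra.
case: (ex_minnP ex) => k kx kmin.
have m0k : (m0 < k)%N.
  by rewrite ltnNge; apply/negP => /(le_exp2N R); lra.
exists k.-1; split; first by lia.
  rewrite leNgt; apply/negP => /kmin; lia.
have -> : 2 ^- k.-1 = 2 * 2 ^- k :> R; last by lra.
have kE : k = k.-1.+1 by lia.
by rewrite [in RHS]kE exprS invfM mulrA divff ?mul1r.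
Qed.

End ScalingExponents.

Theorem theorem3p1 (R : realType) (d : measure_display) (T : measurableType d)
    (P : probability T R) (B : R -> T -> R) (sense : integration_sense)
    (kappa : R) (r : nat) (delta : R)
    (B_bm : standard_brownian_motion P B)
    (kappa_gt0 : 0 < kappa) (r_ge1 : (1 <= r)%N) (delta_gt0 : 0 < delta) :
  exists2 C : T -> R, measurable_fun setT C &
    forall (X : seq 'I_2 -> R -> T -> R) (Z : R -> R -> T -> R[i]),
      is_iterated_integrals sense P B X ->
      {ae P, forall w, forall eps : R, 0 < eps ->
        solves_loewner kappa (eps *i) (B ^~ w) (fun t => Z eps t w)} ->
      {ae P, forall w, exists2 eps0 : R, 0 < eps0 &
        forall eps : R, 0 < eps -> eps < eps0 ->
        forall t : R, 0 <= t -> t <= eps `^ (2 + delta) ->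
        `| Z eps t w
           - taylor_approximation kappa r (eps *i) (fun I => X I t w) |
        <= (C w * eps)%:C}.
Proof.
exists (fun=> 1); first exact: measurable_cst.
move=> X Z XP; have [beta [b3 b2 bd]] := holder_exponent delta_gt0.
have b0 : 0 < beta by lra.
pose lam : R := 2 `^ (- beta).
have l0 : 0 < lam by exact: powR_gt0.
have lamX n : 2 * lam ^+ n = 2 `^ (1 - n%:R * beta).
  rewrite powRD ?powRr1//; last by rewrite pnatr_eq0 implybT.
  have -> : - (n%:R * beta) = - beta * n%:R by ring.
  by rewrite powRrM powR_mulrn ?powR_ge0.
have ln2 : 0 < ln (2 : R) by rewrite ln_gt0// ltr1n.
have pow2 (y : R) : 2 `^ y = expR (y * ln 2) by rewrite /powR pnatr_eq0.
have l2 : 1 < 2 * lam ^+ 2.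
  by rewrite lamX pow2 expR_gt1 mulr_gt0//; lra.
have l3 : 2 * lam ^+ 3 < 1.
  by rewrite lamX pow2 expR_lt1 nmulr_rlt0//; lra.
have dp := driving_path_ae B_bm XP l0 l2 l3.
move: dp; apply: filterS2 => w [A [nl [_ Xord X0 [K [m0 [K1 _ size]]]]]] solZ.
have [L L0 HL] := taylor_error r kappa_gt0 Xord X0.
pose gamma := (2 + delta) * beta - 1.
have gamma0 : 0 < gamma by rewrite /gamma; lra.
pose M := (L + 1) * (K * 2 `^ beta).
have M0 : 0 < M by rewrite !mulr_gt0 ?powR_gt0//; lra.
have d20 : 0 < 2 + delta by lra.
have [e1 e10 He1] := powR_small d20 (exp2N_gt0 R m0).
have Mi0 : 0 < M^-1 by rewrite invr_gt0.
have [e2 e20 He2] := powR_small gamma0 Mi0.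
exists (Num.min e1 e2); first by rewrite lt_min e10.
move=> eps eps0; rewrite lt_min => /andP[ee1 ee2] t t0 tx.
set x := eps `^ (2 + delta) in tx.
have x0 : 0 < x by exact: powR_gt0.
have [m [m0m xm mx]] := dyadic_scale x0 (He1 _ eps0 ee1).
pose sigma := K * lam ^+ m.
have s0 : 0 <= sigma by rewrite mulr_ge0 ?exprn_ge0 ?(ltW l0)//; lra.
have lamE : lam ^+ m = (2 ^- m) `^ beta.
  rewrite -powR_invn// -powRrM -powR_mulrn ?powR_ge0// -powRrM.
  by congr (_ `^ _); ring.
have Ls : (L + 1) * sigma <= eps.
  apply: (@le_trans _ _ ((L + 1) * (K * (2 * x) `^ beta))).
    rewrite !ler_wpM2l//; [lra|lra|].
    rewrite lamE; apply: ge0_ler_powR; rewrite ?nnegrE ?(ltW b0)//.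
    by rewrite mulr_ge0// ltW.
  rewrite powRM ?(ltW x0)// -powRrM.
  have -> : (2 + delta) * beta = 1 + gamma by rewrite /gamma; ring.
  rewrite powRD ?powRr1 ?(ltW eps0)//; last by rewrite (gt_eqF eps0) implybT.
  have -> : (L + 1) * (K * (2 `^ beta * (eps * eps `^ gamma))) =
    eps * (M * eps `^ gamma) by rewrite /M; ring.
  rewrite ger_pMr// mulrC -ler_pdivlMr// div1r.
  exact: He2.
have se : sigma <= eps.
  by apply: le_trans Ls; rewrite ler_peMl//; lra.
have m1 : 2 ^- m <= 1 :> R by have := le_exp2N R (leq0n m); rewrite expr0 invr1.
have tm : t <= 2 ^- m by exact: le_trans xm.
have ts : t <= sigma ^+ 2.
  apply: le_trans tm _; apply: (@le_trans _ _ ((lam ^+ 2) ^+ m)).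
    rewrite -exprVn; apply: lerXn2r; rewrite ?nnegrE ?exprn_ge0 ?(ltW l0)//.
    lra.
  have -> : sigma ^+ 2 = K ^+ 2 * (lam ^+ 2) ^+ m.
    by rewrite /sigma [LHS]exprMn [X in _ * X]exprAC.
  by rewrite ler_peMl ?exprn_ge0 ?(ltW l0)// exprn_ege1.
have bA s : 0 <= s <= t -> `|B s w| <= sigma /\ `|A s| <= sigma ^+ 2.
  by move=> /andP[s1 st]; apply: size => //; rewrite s1 (le_trans st).
have t01 : 0 <= t <= 1 by rewrite t0 (le_trans tm).
apply: le_trans (HL eps sigma t _ eps0 s0 se t01 ts bA (solZ eps eps0)) _.
apply: real_complex_le; rewrite mul1r.
by apply: le_trans Ls; rewrite ler_wpM2r//; lra.
Qed.
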